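(* Let $r\ge0$ be an integer congruent to $0$, $1$ or $2$ modulo $4$, and let $t_1,t_2,t_3\ge0$ be integers (with $r,t_1,t_2,t_3$ not all zero). Then the pseudo $H$-type Lie algebras $\mathfrak n_{r+8t_1+4t_2,\;r+8t_3+4t_2}$ and $\mathfrak n_{r+8t_3+4t_2,\;r+8t_1+4t_2}$ are integral isomorphic.
   Context: For integers $r,s\ge 0$ with $r+s\ge1$, $\mathbb R^{r,s}$ is $\mathbb R^{r+s}$ with $\langle Z,W\rangle_{r,s}=\sum_{i=1}^r Z_iW_i-\sum_{j=r+1}^{r+s}Z_jW_j$, and $\mathrm{Cl}_{r,s}$ is the real unital associative algebra generated by $\mathbb R^{r,s}$ subject to $Z\otimes Z=-\langle Z,Z\rangle_{r,s}\,1$. A scalar product is a non-degenerate (possibly indefinite) symmetric bilinear form. An admissible $\mathrm{Cl}_{r,s}$-module is a non-zero finite-dimensional real vector space $\mathfrak v$ with a representation $J:\mathrm{Cl}_{r,s}\to\mathrm{End}(\mathfrak v)$ and a scalar product $\langle\cdot,\cdot\rangle_{\mathfrak v}$ such that $\langle J_Zv,w\rangle_{\mathfrak v}=-\langle v,J_Zw\rangle_{\mathfrak v}$ for all $Z\in\mathbb R^{r,s}$, $v,w\in\mathfrak v$. It is minimal if its dimension is minimal among admissible $\mathrm{Cl}_{r,s}$-modules. The associated pseudo $H$-type Lie algebra is $\mathfrak n=\mathfrak v\oplus\mathbb R^{r,s}$ (orthogonal sum), with center $\mathbb R^{r,s}$ and bracket $[\cdot,\cdot]:\mathfrak v\times\mathfrak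 v\to\mathbb R^{r,s}$ determined by $\langle J_Zv,w\rangle_{\mathfrak v}=\langle Z,[v,w]\rangle_{r,s}$ for all $Z\in\mathbb R^{r,s}$, $v,w\in\mathfrak v$. The notation $\mathfrak n_{r,s}=\mathfrak v_{r,s}\oplus\mathfrak z_{r,s}$, $\mathfrak z_{r,s}=\mathbb R^{r,s}$, stands for the pseudo $H$-type Lie algebra built from a minimal admissible module $\mathfrak v_{r,s}$ (for $s=0$ the scalar product on $\mathfrak v_{r,0}$ is positive definite). Integral basis: a basis $\{v_1,\dots,v_m,Z_1,\dots,Z_n\}$ of a pseudo $H$-type Lie algebra $\mathfrak v\oplus\mathfrak z$, orthonormal (pairwise orthogonal, with $\langle x,x\rangle=\pm1$ for each basis vector $x$), with $v_\alpha\in\mathfrak v$, $Z_k\in\mathfrak z$, such that each $[v_\alpha,v_\beta]$ is either $0$ or $\pm Z_k$ for some $k$, and for all $k,\alpha$ there is exactly one $\beta$ with $[v_\alpha,v_\beta]=\pm Z_k$. Two pseudo $H$-type Lie algebras $\mathfrak n,\tilde{\mathfrak n}$ are integral isomorphic if there are integral bases $\{v_1,\dots,v_m,Z_1,\dots,Z_n\}$ of $\mathfrak n$ and $\{\tilde v_1,\dots,\tilde v_m,\tilde Z_1,\dots,\tilde Z_n\}$ of $\tilde{\mathfrak n}$ and a Lie algebra isomorphism $f:\mathfrak n\to\tilde{\mathfrak n}$ with $f(v_i)=\tilde v_i$ and $f(Z_k)=\tilde Z_k$ for all $i,k$. *)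

(* Defs.v *)
From HB Require Import structures.
From mathcomp Require Import all_boot all_order all_algebra.
From mathcomp Require Import boolp reals.
From mathcomp Require Import generic_quotient ring.

Set Implicit Arguments.
Unset Strict Implicit.
Unset Printing Implicit Defensive.
Import Order.TTheory GRing.Theory Num.Theory.
Local Open Scope ring_scope.

Section PseudoEuclidean.
Variables (R : realType) (r s : nat).
Implicit Types Z W : 'rV[R]_(r + s).

Definition pe_form Z W : R :=
  \sum_(i < r) Z 0 (lshift s i) * W 0 (lshift s i)
  - \sum_(j < s) Z 0 (rshift r j) * W 0 (rshift r j).

(* <e_k, e_k> *)
Definition pe_sign (k : 'I_(r + s)) : R := if (k < r)%N then 1 else -1.

Lemma pe_signK k : pe_sign k * pe_sign k = 1.
Proof. by rewrite /pe_sign; case: ifP; rewrite ?mulrNN mulr1. Qed.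

Lemma pe_formE Z W : pe_form Z W = \sum_k pe_sign k * (Z 0 k * W 0 k).
Proof.
rewrite big_split_ord /pe_form -sumrN; congr (_ + _); apply: eq_bigr => i _.
  by rewrite /pe_sign /= ltn_ord mul1r.
by rewrite /pe_sign /= ltnNge leq_addr mulN1r.
Qed.

Lemma pe_form_is_bilinear : bilinear_for *%R *%R pe_form.
Proof.
split=> [W|Z] a X Y; rewrite /= !pe_formE mulr_sumr -big_split /=;
  by apply: eq_bigr => k _; rewrite !mxE; ring.
Qed.
HB.instance Definition _ := bilinear_isBilinear.Build R
  'rV[R]_(r + s) 'rV[R]_(r + s) R *%R *%R pe_form pe_form_is_bilinear.

Lemma pe_formC Z W : pe_form Z W = pe_form W Z.
Proof. by congr (_ - _); apply: eq_bigr => i _; rewrite mulrC. Qed.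

End PseudoEuclidean.

(* The Clifford algebra Cl_{r,s} is built from its presentation: terms over the
   generators Z in R^{r,s} and the scalars, modulo the congruence generated by
   the axioms of unital associative R-algebras, the linearity of Z |-> Z, and
   Z * Z = - <Z, Z> 1. *)

Section CliffordTerms.
Variables (R : realType) (r s : nat).

Inductive cl_term : Type :=
  | CGen of 'rV[R]_(r + s)
  | CScal of R
  | CAdd of cl_term & cl_term
  | CMul of cl_term & cl_term.

Inductive cl_eq : cl_term -> cl_term -> Prop :=
  | cl_refl x : cl_eq x x
  | cl_sym x y : cl_eq x y -> cl_eq y x
  | cl_trans y x z : cl_eq x y -> cl_eq y z -> cl_eq x z
  | cl_addm x x' y y' :
      cl_eq x x' -> cl_eq y y' -> cl_eq (CAdd x y) (CAdd x' y')
  | cl_mulm x x' y y' :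
      cl_eq x x' -> cl_eq y y' -> cl_eq (CMul x y) (CMul x' y')
  | cl_addA x y z : cl_eq (CAdd x (CAdd y z)) (CAdd (CAdd x y) z)
  | cl_addC x y : cl_eq (CAdd x y) (CAdd y x)
  | cl_add0 x : cl_eq (CAdd (CScal 0) x) x
  | cl_addN x : cl_eq (CAdd (CMul (CScal (-1)) x) x) (CScal 0)
  | cl_mulA x y z : cl_eq (CMul x (CMul y z)) (CMul (CMul x y) z)
  | cl_mul1 x : cl_eq (CMul (CScal 1) x) x
  | cl_mulDl x y z : cl_eq (CMul (CAdd x y) z) (CAdd (CMul x z) (CMul y z))
  | cl_mulDr x y z : cl_eq (CMul x (CAdd y z)) (CAdd (CMul x y) (CMul x z))
  | cl_scalD a b : cl_eq (CScal (a + b)) (CAdd (CScal a) (CScal b))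
  | cl_scalM a b : cl_eq (CScal (a * b)) (CMul (CScal a) (CScal b))
  | cl_scalC a x : cl_eq (CMul (CScal a) x) (CMul x (CScal a))
  | cl_genD Z W : cl_eq (CGen (Z + W)) (CAdd (CGen Z) (CGen W))
  | cl_genZ a Z : cl_eq (CGen (a *: Z)) (CMul (CScal a) (CGen Z))
  | cl_square Z : cl_eq (CMul (CGen Z) (CGen Z)) (CScal (- pe_form Z Z)).

HB.instance Definition _ := gen_eqMixin cl_term.
HB.instance Definition _ := gen_choiceMixin cl_term.

Definition cl_eqb (x y : cl_term) : bool := `[< cl_eq x y >].

Lemma cl_eqb_refl : reflexive cl_eqb.
Proof. by move=> x; apply/asboolP/cl_refl. Qed.
Lemma cl_eqb_sym : symmetric cl_eqb.
Proof. by move=> x y; apply/asboolP/asboolP => /cl_sym. Qed.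
Lemma cl_eqb_trans : transitive cl_eqb.
Proof.
by move=> y x z /asboolP xy /asboolP yz; apply/asboolP; apply: cl_trans yz.
Qed.

Canonical cl_equiv := EquivRel cl_eqb cl_eqb_refl cl_eqb_sym cl_eqb_trans.

End CliffordTerms.

Section CliffordEval.
Variables (R : realType) (r s : nat) (A : algType R).
Variable f : {linear 'rV[R]_(r + s) -> A}.
Hypothesis f_square : forall Z, f Z * f Z = (- pe_form Z Z)%:A.

Fixpoint cl_eval (x : cl_term R r s) : A :=
  match x with
  | CGen Z => f Z
  | CScal a => a%:A
  | CAdd x y => cl_eval x + cl_eval y
  | CMul x y => cl_eval x * cl_eval y
  end.

Lemma cl_eval_eq x y : cl_eq x y -> cl_eval x = cl_eval y.
Proof.
elim=> //=.
- by move=> ? ? ? _ -> _ ->.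
- by move=> ? ? ? ? _ -> _ ->.
- by move=> ? ? ? ? _ -> _ ->.
- by move=> *; rewrite addrA.
- by move=> *; rewrite addrC.
- by move=> *; rewrite scale0r add0r.
- by move=> z; rewrite mulr_algl scaleN1r addNr scale0r.
- by move=> *; rewrite mulrA.
- by move=> *; rewrite scale1r mul1r.
- by move=> *; rewrite mulrDl.
- by move=> *; rewrite mulrDr.
- by move=> *; rewrite scalerDl.
- by move=> *; rewrite mulr_algl scalerA.
- by move=> *; rewrite mulr_algl mulr_algr.
- by move=> *; rewrite linearD.
- by move=> *; rewrite linearZ /= mulr_algl.
Qed.

End CliffordEval.

(* Anticommuting matrices with prescribed squares; they show that 1 <> 0 in
   the Clifford algebra. *)
Lemma anticommuting_matrices (R : realType) (n : nat) (c : 'I_n -> R) :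
  exists (m : nat) (E : 'I_n -> 'M[R]_m.+1),
    (forall k, E k * E k = (c k)%:A) /\
    (forall k l, k != l -> E k * E l = - (E l * E k)).
Proof.
elim: n c => [|n IHn] c.
  by exists 0%N, (fun=> 0); split=> -[].
have [m [E [E2 EC]]] := IHn (fun k => c (lift ord0 k)).
pose d k : 'M[R]_(m.+1 + m.+1) := block_mx (E k) 0 0 (- E k).
pose e : 'M[R]_(m.+1 + m.+1) := block_mx 0 (c ord0)%:M 1%:M 0.
have dd k l : d k *m d l = block_mx (E k * E l) 0 0 (E k * E l).
  by rewrite mulmx_block !(mulmx0, mul0mx, addr0, add0r) mulNmx mulmxN opprK.
have ddC k l : k != l -> d k *m d l = - (d l *m d k).
  by move=> kl; rewrite !dd EC // opp_block_mx !oppr0.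
have ee : e *m e = (c ord0)%:M.
  rewrite mulmx_block !(mulmx0, mul0mx, addr0, add0r, mulmx1, mul1mx).
  by rewrite -scalar_mx_block.
have de k : d k *m e = - (e *m d k).
  rewrite !mulmx_block !(mulmx0, mul0mx, addr0, add0r, mulmx1, mul1mx).
  by rewrite opp_block_mx !oppr0 mul_mx_scalar mul_scalar_mx scalerN opprK.
exists (m + m.+1)%N.
exists (fun k => if unlift ord0 k is Some k' then d k' else e); split.
  move=> k; case: unliftP => [k' ->|->].
    rewrite scalemx1; apply: (etrans (dd _ _)).
    by rewrite E2 scalemx1 -scalar_mx_block.
  by rewrite scalemx1; apply: ee.
move=> k l; case: unliftP => [k' ->|->]; case: unliftP => [l' ->|->] //.
- rewrite (inj_eq lift_inj) => kl.
  by apply: ddC.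
- by move=> _; apply: de.
- by move=> _; apply/eqP; rewrite -eqr_oppLR eq_sym; apply/eqP/de.
Qed.

Lemma cl_nontrivial (R : realType) (r s : nat) :
  ~ cl_eq (CScal r s 1) (CScal r s (0 : R)).
Proof.
have [m [E [E2 EC]]] :=
  anticommuting_matrices (fun k : 'I_(r + s) => - pe_sign R k).
pose f (Z : 'rV[R]_(r + s)) := \sum_k Z 0 k *: E k.
have f_lin : linear f.
  move=> a Z W; rewrite /f scaler_sumr -big_split; apply: eq_bigr => k _ /=.
  by rewrite !mxE scalerDl scalerA.
pose fl := GRing.isLinear.Build R _ _ _ f f_lin.
pose F : {linear 'rV[R]_(r + s) -> 'M[R]_m.+1} := HB.pack f fl.
have F_square Z : F Z * F Z = (- pe_form Z Z)%:A.
  rewrite /F /= /f mulr_suml.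
  under eq_bigr do rewrite mulr_sumr.
  set S := LHS.
  have S2 : S + S = (- pe_form Z Z)%:A + (- pe_form Z Z)%:A.
    rewrite {2}/S exchange_big -big_split /=.
    rewrite pe_formE -sumrN scaler_suml -big_split /=.
    apply: eq_bigr => k _; rewrite -big_split /= (bigD1 k) //= big1 => [|l lk].
      by rewrite addr0 -scalerAl -scalerAr E2 !scalerA; congr (_ *: _ + _ *: _);
        ring.
    rewrite -!scalerAl -!scalerAr !scalerA (EC _ _ lk) scalerN.
    by rewrite [Z 0 l * Z 0 k]mulrC addrN.
  apply: (scalerI (a := 2%:R)); first by rewrite pnatr_eq0.
  by rewrite !scaler_nat !mulr2n.
move=> /(cl_eval_eq F_square) /=.
by move/eqP; rewrite scale0r scale1r oner_eq0.
Qed.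

Definition Cl (R : realType) (r s : nat) : Type :=
  {eq_quot (@cl_equiv R r s)}%qT.

Section CliffordAlgebra.
Variables (R : realType) (r s : nat).
Local Open Scope quotient_scope.
Local Notation Cl := (Cl R r s).

HB.instance Definition _ := Choice.on Cl.

Definition cl_pi (x : cl_term R r s) : Cl := \pi_{eq_quot (cl_equiv R r s)} x.
Definition cl_repr (u : Cl) : cl_term R r s :=
  repr (u : {eq_quot (cl_equiv R r s)}).

Lemma cl_piP x y : cl_pi x = cl_pi y <-> cl_eq x y.
Proof.
split=> [/eqmodP /asboolP //|xy]; by apply/eqmodP/asboolP.
Qed.

Lemma cl_reprK u : cl_pi (cl_repr u) = u.
Proof. exact: reprK. Qed.

Lemma cl_repr_pi x : cl_eq (cl_repr (cl_pi x)) x.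
Proof. by apply/cl_piP; rewrite cl_reprK. Qed.

Definition cl_scal (a : R) : Cl := cl_pi (CScal _ _ a).
Definition cl_add (u v : Cl) : Cl := cl_pi (CAdd (cl_repr u) (cl_repr v)).
Definition cl_mul (u v : Cl) : Cl := cl_pi (CMul (cl_repr u) (cl_repr v)).
Definition cl_opp (u : Cl) : Cl := cl_mul (cl_scal (-1)) u.
Definition cl_scale (a : R) (u : Cl) : Cl := cl_mul (cl_scal a) u.

Lemma cl_addE x y : cl_add (cl_pi x) (cl_pi y) = cl_pi (CAdd x y).
Proof. by apply/cl_piP/cl_addm; apply: cl_repr_pi. Qed.
Lemma cl_mulE x y : cl_mul (cl_pi x) (cl_pi y) = cl_pi (CMul x y).
Proof. by apply/cl_piP/cl_mulm; apply: cl_repr_pi. Qed.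

Lemma cl_ind (P : Cl -> Prop) : (forall x, P (cl_pi x)) -> forall u, P u.
Proof. by move=> Ppi u; rewrite -(cl_reprK u). Qed.

Let addA : associative cl_add.
Proof.
elim/cl_ind=> x; elim/cl_ind=> y; elim/cl_ind=> z.
by rewrite !cl_addE; apply/cl_piP/cl_addA.
Qed.
Let addC : commutative cl_add.
Proof.
by elim/cl_ind=> x; elim/cl_ind=> y; rewrite !cl_addE; apply/cl_piP/cl_addC.
Qed.
Let add0 : left_id (cl_scal 0) cl_add.
Proof. by elim/cl_ind=> x; rewrite cl_addE; apply/cl_piP/cl_add0. Qed.
Let addN : left_inverse (cl_scal 0) cl_opp cl_add.
Proof.
by elim/cl_ind=> x; rewrite /cl_opp cl_mulE cl_addE; apply/cl_piP/cl_addN.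
Qed.
HB.instance Definition _ := GRing.isZmodule.Build Cl addA addC add0 addN.

Let mulA : associative cl_mul.
Proof.
elim/cl_ind=> x; elim/cl_ind=> y; elim/cl_ind=> z.
by rewrite !cl_mulE; apply/cl_piP/cl_mulA.
Qed.
Let scalC a u : cl_mul (cl_scal a) u = cl_mul u (cl_scal a).
Proof. by elim/cl_ind: u => x; rewrite !cl_mulE; apply/cl_piP/cl_scalC. Qed.
Let mul1 : left_id (cl_scal 1) cl_mul.
Proof. by elim/cl_ind=> x; rewrite cl_mulE; apply/cl_piP/cl_mul1. Qed.
Let mulr1 : right_id (cl_scal 1) cl_mul.
Proof. by move=> u; rewrite -scalC mul1. Qed.
Let mulDl : left_distributive cl_mul cl_add.
Proof.
elim/cl_ind=> x; elim/cl_ind=> y; elim/cl_ind=> z.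
by rewrite !(cl_addE, cl_mulE); apply/cl_piP/cl_mulDl.
Qed.
Let mulDr : right_distributive cl_mul cl_add.
Proof.
elim/cl_ind=> x; elim/cl_ind=> y; elim/cl_ind=> z.
by rewrite !(cl_addE, cl_mulE); apply/cl_piP/cl_mulDr.
Qed.
Let one_neq0 : cl_scal 1 != 0 :> Cl.
Proof. by apply/eqP => /cl_piP; apply: cl_nontrivial. Qed.
HB.instance Definition _ :=
  GRing.Zmodule_isNzRing.Build Cl mulA mul1 mulr1 mulDl mulDr one_neq0.

Let scaleA a b u : cl_scale a (cl_scale b u) = cl_scale (a * b) u.
Proof.
rewrite /cl_scale mulA; congr cl_mul.
by rewrite cl_mulE; apply/cl_piP/cl_sym/cl_scalM.
Qed.
Let scaleDr : right_distributive cl_scale +%R.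
Proof. by move=> a u v; apply: mulDr. Qed.
Let scaleDl u : {morph cl_scale^~ u : a b / a + b}.
Proof.
move=> a b; rewrite /cl_scale [RHS](esym (mulDl _ _ _)); congr cl_mul.
by rewrite cl_addE; apply/cl_piP/cl_scalD.
Qed.
HB.instance Definition _ :=
  GRing.Zmodule_isLmodule.Build R Cl scaleA mul1 scaleDr scaleDl.

Let scaleAl (a : R) (u v : Cl) : a *: (u * v) = (a *: u) * v.
Proof. exact: mulA. Qed.
HB.instance Definition _ := GRing.LSemiModule_isLSemiAlgebra.Build R Cl scaleAl.

Let scaleAr (a : R) (u v : Cl) : a *: (u * v) = u * (a *: v).
Proof.
change (cl_mul (cl_scal a) (cl_mul u v) = cl_mul u (cl_mul (cl_scal a) v)).
by rewrite !mulA scalC.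
Qed.
HB.instance Definition _ := GRing.LSemiAlgebra_isSemiAlgebra.Build R Cl scaleAr.

Definition cl_gen (Z : 'rV[R]_(r + s)) : Cl := cl_pi (CGen Z).

Lemma cl_gen_is_linear : linear cl_gen.
Proof.
move=> a Z W; change (cl_gen (a *: Z + W) =
  cl_add (cl_mul (cl_scal a) (cl_gen Z)) (cl_gen W)).
rewrite cl_mulE cl_addE; apply/cl_piP.
by apply: (cl_trans (cl_genD _ _)); apply: cl_addm (cl_refl _); apply: cl_genZ.
Qed.
HB.instance Definition _ :=
  GRing.isLinear.Build R 'rV[R]_(r + s) Cl *:%R cl_gen cl_gen_is_linear.

Lemma cl_scalE a : cl_scal a = a%:A.
Proof. by apply/esym/mulr1. Qed.

Lemma cl_gen_square Z : cl_gen Z * cl_gen Z = (- pe_form Z Z)%:A.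
Proof.
by rewrite -cl_scalE; apply: (etrans (cl_mulE _ _)); apply/cl_piP/cl_square.
Qed.

Section Universal.
Variables (A : algType R) (f : {linear 'rV[R]_(r + s) -> A}).
Hypothesis f_square : forall Z, f Z * f Z = (- pe_form Z Z)%:A.

Definition cl_lift (u : Cl) : A := cl_eval f (cl_repr u).

Lemma cl_lift_pi x : cl_lift (cl_pi x) = cl_eval f x.
Proof. exact/(cl_eval_eq f_square)/cl_repr_pi. Qed.

Lemma cl_lift_is_linear : linear cl_lift.
Proof.
move=> a; elim/cl_ind=> x; elim/cl_ind=> y.
change (cl_lift (cl_add (cl_mul (cl_scal a) (cl_pi x)) (cl_pi y)) =
  a *: cl_lift (cl_pi x) + cl_lift (cl_pi y)).
by rewrite cl_mulE cl_addE !cl_lift_pi /= mulr_algl.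
Qed.
HB.instance Definition _ :=
  GRing.isLinear.Build R Cl A *:%R cl_lift cl_lift_is_linear.

Lemma cl_lift_is_monoid_morphism : monoid_morphism cl_lift.
Proof.
split; first by rewrite [LHS]cl_lift_pi /= scale1r.
elim/cl_ind=> x; elim/cl_ind=> y.
change (cl_lift (cl_mul (cl_pi x) (cl_pi y)) =
  cl_lift (cl_pi x) * cl_lift (cl_pi y)).
by rewrite cl_mulE !cl_lift_pi.
Qed.
HB.instance Definition _ :=
  GRing.isMonoidMorphism.Build Cl A cl_lift cl_lift_is_monoid_morphism.

Lemma Cl_universal :
  exists2 g : {lrmorphism Cl -> A}, (forall Z, g (cl_gen Z) = f Z) &
    forall h : {lrmorphism Cl -> A}, (forall Z, h (cl_gen Z) = f Z) -> h =1 g.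
Proof.
exists cl_lift => [Z|h hf]; first exact: cl_lift_pi.
elim/cl_ind; elim=> [Z|a|x IHx y IHy|x IHx y IHy]; rewrite [RHS]cl_lift_pi /=.
- exact: hf.
- by rewrite [X in h X]cl_scalE rmorph_alg.
- by rewrite -cl_addE -!cl_lift_pi -IHx -IHy; apply: (rmorphD h).
- by rewrite -cl_mulE -!cl_lift_pi -IHx -IHy; apply: (rmorphM h).
Qed.

End Universal.

End CliffordAlgebra.

Record admissible_module (R : realType) (r s : nat) := AdmissibleModule {
  am_space : vectType R;
  am_rep : {linear Cl R r s -> 'End(am_space)};
  am_form : {symmetric am_space};
  am_rep1 : am_rep 1 = \1%VF;
  am_repM : forall a b, am_rep (a * b) = (am_rep a \o am_rep b)%VF;
  am_nonzero : (0 < \dim {:am_space})%N;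
  am_nondegenerate : nondegenerate am_form;
  am_skew : forall (Z : 'rV[R]_(r + s)) (v w : am_space),
    am_form (am_rep (cl_gen Z) v) w = - am_form v (am_rep (cl_gen Z) w)
}.

Section Admissible.
Variables (R : realType) (r s : nat).

Definition minimal_admissible (M : admissible_module R r s) : Prop :=
  forall N : admissible_module R r s,
    (\dim {:am_space M} <= \dim {:am_space N})%N.

(* The modules v_{r,s} from which n_{r,s} is built: for s = 0 both signs of the
   scalar product are admissible, and the positive one is chosen. *)
Definition standard_module (M : admissible_module R r s) : Prop :=
  minimal_admissible M /\
  (s = 0%N -> forall v : am_space M, v != 0 -> 0 < am_form M v v).

End Admissible.

Record lie_algebra (R : realType) := LieAlgebra {
  lie_space :> vectType R;
  lie_br : {bilinear lie_space -> lie_space -> lie_space};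
  lie_alt : forall x, lie_br x x = 0;
  lie_jacobi : forall x y z,
    lie_br x (lie_br y z) + lie_br y (lie_br z x) + lie_br z (lie_br x y) = 0
}.

Definition lie_isomorphism (R : realType) (L L' : lie_algebra R)
    (f : {linear L -> L'}) : Prop :=
  bijective f /\ forall x y, f (lie_br L x y) = lie_br L' (f x) (f y).

Section PseudoHType.
Variables (R : realType) (r s : nat) (M : admissible_module R r s).
Local Notation V := (am_space M).
Local Notation Zsp := 'rV[R]_(r + s).
Local Notation J Z := (am_rep M (cl_gen Z)).

(* The bracket is determined by <J_Z v, w> = <Z, [v, w]>, whence its k-th
   coordinate <e_k, e_k> <e_k, [v, w]>; see h_bracketP and h_bracket_unique. *)
Definition h_bracket (v w : V) : Zsp :=
  \row_k (pe_sign R k * am_form M (J (delta_mx 0 k) v) w).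

Lemma h_bracketP Z v w : am_form M (J Z v) w = pe_form Z (h_bracket v w).
Proof.
rewrite pe_formE {1}[Z]row_sum_delta !linear_sum sum_lfunE linear_sumlz.
apply: eq_bigr => k _.
rewrite !linearZ scale_lfunE linearZl_LR /= mxE.
by rewrite mulrCA [in RHS](mulrA (pe_sign R k)) pe_signK mul1r.
Qed.

Lemma h_bracket_unique v w U :
  (forall Z, am_form M (J Z v) w = pe_form Z U) -> U = h_bracket v w.
Proof.
move=> UP; apply/rowP => k; rewrite mxE UP pe_formE (bigD1 k) //= big1.
  by rewrite addr0 mxE !eqxx mul1r mulrA pe_signK mul1r.
by move=> i ik; rewrite mxE eqxx (negPf ik) mul0r mulr0.
Qed.

Definition h_space : vectType R := (V * Zsp)%type.

Definition h_form (x y : h_space) : R := am_form M x.1 y.1 + pe_form x.2 y.2.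

Definition h_lie_br (x y : h_space) : h_space := (0, h_bracket x.1 y.1).

Lemma h_lie_br_is_bilinear : bilinear_for *:%R *:%R h_lie_br.
Proof.
split=> [y|x] a u v; apply/pair_equal_spec; split=> /=.
- by rewrite scaler0 addr0.
- by apply/rowP => k; rewrite !mxE !linearP linearPl mulrDr mulrCA.
- by rewrite scaler0 addr0.
- by apply/rowP => k; rewrite !mxE linearPr mulrDr mulrCA.
Qed.
HB.instance Definition _ := bilinear_isBilinear.Build R
  h_space h_space h_space *:%R *:%R h_lie_br h_lie_br_is_bilinear.

Lemma h_lie_alt x : h_lie_br x x = 0.
Proof.
congr (_, _); apply/rowP => k; rewrite !mxE.
have /eqP := am_skew (delta_mx 0 k) x.1 x.1.
rewrite [X in - X]hermC /= expr0 mul1r.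
by rewrite -addr_eq0 -mulr2n mulrn_eq0 /= => /eqP ->; rewrite mulr0.
Qed.

Lemma h_lie_jacobi x y z :
  h_lie_br x (h_lie_br y z) + h_lie_br y (h_lie_br z x)
    + h_lie_br z (h_lie_br x y) = 0.
Proof.
have br0 u v w : h_lie_br u (h_lie_br v w) = 0.
  by congr (_, _); apply/rowP => k; rewrite !mxE linear0r mulr0.
by rewrite !br0 !addr0.
Qed.

Definition pseudo_H_type : lie_algebra R :=
  @LieAlgebra R h_space h_lie_br h_lie_alt h_lie_jacobi.

Definition in_v (v : V) : pseudo_H_type := (v, 0).
Definition in_z (Z : Zsp) : pseudo_H_type := (0, Z).

Definition integral_basis (m n : nat) (v : 'I_m -> V) (Z : 'I_n -> Zsp) : Prop :=
  let b := [seq in_v (v i) | i <- enum 'I_m] ++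
           [seq in_z (Z k) | k <- enum 'I_n] in
  [/\ basis_of {:pseudo_H_type} b,
      (forall i j : 'I_(m + n), i != j -> h_form b`_i b`_j = 0) /\
      (forall x, x \in b -> h_form x x = 1 \/ h_form x x = -1),
      forall i j, let c := lie_br pseudo_H_type (in_v (v i)) (in_v (v j)) in
        c = 0 \/ exists k, c = in_z (Z k) \/ c = - in_z (Z k)
    & forall k i, exists! j,
        let c := lie_br pseudo_H_type (in_v (v i)) (in_v (v j)) in
        c = in_z (Z k) \/ c = - in_z (Z k)].

End PseudoHType.

Definition integral_isomorphic (R : realType) (r s r' s' : nat)
    (M : admissible_module R r s) (M' : admissible_module R r' s') : Prop :=
  exists (m n : nat)
    (v : 'I_m -> am_space M) (Z : 'I_n -> 'rV[R]_(r + s))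
    (v' : 'I_m -> am_space M') (Z' : 'I_n -> 'rV[R]_(r' + s'))
    (f : {linear pseudo_H_type M -> pseudo_H_type M'}),
  [/\ integral_basis v Z, integral_basis v' Z', lie_isomorphism f,
      forall i, f (in_v (v i)) = in_v (v' i)
    & forall k, f (in_z M (Z k)) = in_z M' (Z' k)].

(* Main.v *)
From HB Require Import structures.
Require Import Defs.
From mathcomp Require Import all_boot all_order all_algebra.
From mathcomp Require Import reals ring.

Set Implicit Arguments.
Unset Strict Implicit.
Unset Printing Implicit Defensive.
Import Order.TTheory GRing.Theory Num.Theory.
Local Open Scope ring_scope.

(**
   The two signatures are (p, q) and (q, p), where p and q differ by a multiple
   of 8 and are both congruent to 0, 1 or 2 modulo 4.

   Let e_k be the orthonormal generators of Cl_{p,q}, and for a set I of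
   generators let e_I be their ordered product.  A minimal admissible module
   is found inside any admissible one as the orbit of a single vector v that
   is fixed by enough commuting involutions e_w.  The words w are the
   generators of a binary code C, all of weight 4 with an even number of
   letters of negative sign, and any two meet in an even number of letters;
   so every e_w is an involution, self-adjoint for the scalar product S of the
   module, and they commute.  The 8 (t1 + t2 + t3) + 8 (r %/ 4) generators
   beyond the first 2 (r %% 4) fall into blocks of 8, each carrying the
   extended Hamming code; for r %% 4 = 2 the remaining four generators form
   one further word.

   - A vector v with S v v <> 0 fixed by all e_w exists
     (exists_fixed_nonnull): a nonnull v splits orthogonally under e_w into
     eigenvectors, one of which is nonnull, and if only the eigenvalue -1
     occurs, a generator that belongs to w and to no other word exchanges the
     two eigenspaces.
   - The vectors e_I v, with I a set of information letters of the code, are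
     pairwise orthogonal (orbit_orthogonal): S (e_I v) (e_L v) is, up to sign,
     S v (e_D v) with D the symmetric difference of I and L, and e_D is either
     skew-adjoint or anticommutes with some e_w.  This is where the congruence
     modulo 4 enters (has_signed_code_mod4).
   - Their span is stable under the generators (code_orbit) and nondegenerate,
     hence it is an admissible submodule, hence everything by minimality
     (orbit_orthobasis).  In this orthonormal basis the generators act by
     signed permutations, which makes it an integral basis
     (frame_integral_basis).

   The code serves both signatures, because in a word of weight 4 the letters
   of positive sign are even in number as well.  For generators J' of the
   opposite signature, the operators (x, y) |-> (J' y, - J' x) on the double
   of the second module have the original signature, so that one and the same
   signed permutation describes both orbits once the vectors e'_I v' are
   rescaled by signs that depend on the cardinal of I (simultaneous_orbits).
   After this the structure constants of the two Lie algebras agree up to one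
   global sign, which is absorbed into the basis of the center
   (swapped_integral_isomorphic).
*)

(** * Words of generators acting on a module *)

Section EqualUpToSign.
Variables (R : comNzRingType) (W : lmodType R).
Implicit Types x y z : W.

Definition eqpm x y := exists b : bool, x = (-1) ^+ b *: y.

Lemma eqpm_refl x : eqpm x x.
Proof. by exists false; rewrite expr0 scale1r. Qed.

Lemma eqpm_sym x y : eqpm x y -> eqpm y x.
Proof. by move=> [b ->]; exists b; rewrite scalerA -signr_addb addbb scale1r. Qed.

Lemma eqpm_trans y x z : eqpm x y -> eqpm y z -> eqpm x z.
Proof.
by move=> [b ->] [c ->]; exists (b (+) c); rewrite scalerA signr_addb.
Qed.

End EqualUpToSign.

Section CliffordAction.
Variables (R : comNzRingType) (K : finType).

(** The generators are indexed by an arbitrary finite type, and k squares to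
    -1 when eps k holds, to 1 otherwise.  Abstracting from Cl_{r,s} lets the
    same lemmas apply to products and twists of modules. *)
Record clifford_action (eps : pred K) (W : lmodType R) (J : K -> W -> W) :
    Prop := CliffordAction {
  ca_linear : forall k, linear (J k);
  ca_square : forall k x, J k (J k x) = (-1) ^+ eps k *: x;
  ca_anti : forall k l x, k != l -> J k (J l x) = - J l (J k x) }.

Definition word_act (W : lmodType R) (J : K -> W -> W) (s : seq K) (x : W) : W :=
  foldr J x s.

Variables (eps : pred K) (W : lmodType R) (J : K -> W -> W).
Hypothesis JP : clifford_action eps J.
Implicit Types (k l : K) (s t : seq K) (x y : W).
Local Notation act := (word_act J).

Lemma ca_add k x y : J k (x + y) = J k x + J k y.
Proof. by rewrite -[x]scale1r (ca_linear JP) !scale1r. Qed.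

Lemma ca_scale k a x : J k (a *: x) = a *: J k x.
Proof.
have J0 : J k 0 = 0 by apply: (addrI (J k 0)); rewrite -ca_add !addr0.
by rewrite -[a *: x]addr0 (ca_linear JP) J0 addr0.
Qed.

Lemma act_cat s t x : act (s ++ t) x = act s (act t x).
Proof. exact: foldr_cat. Qed.

Lemma act_scale s a x : act s (a *: x) = a *: act s x.
Proof. by elim: s => //= k s ->; rewrite ca_scale. Qed.

Lemma act_eqpm s x y : eqpm x y -> eqpm (act s x) (act s y).
Proof. by move=> [b ->]; exists b; rewrite act_scale. Qed.

Lemma gen_eqpm k x y : eqpm x y -> eqpm (J k x) (J k y).
Proof. exact: (@act_eqpm [:: k]). Qed.

Lemma gen_square_eqpm k x : eqpm (J k (J k x)) x.
Proof. by exists (eps k); rewrite (ca_square JP). Qed.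

Lemma act_genC s k x : uniq s ->
  act s (J k x) = (-1) ^+ (odd (size s) (+) (k \in s)) *: J k (act s x).
Proof.
elim: s => [|l s IHs] /=; first by rewrite scale1r.
move=> /andP[ls /IHs ->]; rewrite ca_scale inE.
have [->|kl] := eqVneq k l; first by rewrite (negPf ls) addbF addbT negbK.
rewrite (ca_anti JP); last by rewrite eq_sym.
by rewrite /= -scaleN1r scalerA -(signr_addb R _ true) addbT -addNb.
Qed.

Lemma act_gen_eqpm s k x : eqpm (act s (J k x)) (J k (act s x)).
Proof.
elim: s => [|l s IHs] /=; first exact: eqpm_refl.
apply: eqpm_trans (gen_eqpm l IHs) _.
have [->|kl] := eqVneq l k; first exact: eqpm_refl.
by rewrite (ca_anti JP) //; exists true; rewrite scaleN1r.
Qed.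

Lemma act_perm s t x : perm_eq s t -> eqpm (act s x) (act t x).
Proof.
elim: s t => [|k s IHs] t.
  by rewrite perm_sym => /perm_nilP ->; apply: eqpm_refl.
move=> st; have kt : k \in t by rewrite -(perm_mem st) mem_head.
case/splitPr: kt st => t1 t2.
rewrite perm_sym perm_catC /= perm_cons perm_catC perm_sym => /IHs.
move=> /(gen_eqpm k) /= /eqpm_trans; apply.
rewrite !act_cat; exact/eqpm_sym/act_gen_eqpm.
Qed.

(** The generators that survive in a word after equal letters are cancelled in
    pairs. *)
Definition odd_letters s : {set K} := [set k | odd (count_mem k s)].

Lemma act_normal_form s x : eqpm (act s x) (act (enum (odd_letters s)) x).
Proof.
elim: s => [|k s IHs].
  rewrite (_ : odd_letters [::] = set0) ?enum_set0; first exact: eqpm_refl.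
  by apply/setP => k; rewrite !inE.
apply: eqpm_trans (gen_eqpm k IHs) _; set A := odd_letters s.
have [kA|kA] := boolP (k \in A).
  have -> : odd_letters (k :: s) = A :\ k.
    apply/setP => l; rewrite !inE /= oddD eq_sym.
    have [->|lk] := eqVneq l k; last by rewrite addFb.
    by move: kA; rewrite inE => ->.
  have kAP : perm_eq (enum A) (k :: enum (A :\ k)).
    apply: uniq_perm; rewrite /= ?enum_uniq ?mem_enum ?inE ?eqxx //.
    move=> l; rewrite inE !mem_enum !inE; case: eqVneq => // ->.
    by rewrite -[RHS]kA inE.
  apply: eqpm_trans (gen_eqpm k (act_perm x kAP)) _.
  exact: gen_square_eqpm.
have -> : odd_letters (k :: s) = k |: A.
  apply/setP => l; rewrite !inE /= oddD eq_sym.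
  have [->|lk] := eqVneq l k; last by rewrite addFb.
  by move: kA; rewrite inE => /negPf ->.
apply: (@act_perm (k :: enum A)); apply: uniq_perm.
- by rewrite /= mem_enum kA enum_uniq.
- exact: enum_uniq.
- by move=> l; rewrite inE !mem_enum !inE.
Qed.

(** Reversing n anticommuting letters takes n (n - 1) / 2 transpositions, a
    number of the same parity as n./2. *)
Lemma act_rev s x : uniq s -> act (rev s) x = (-1) ^+ (size s)./2 *: act s x.
Proof.
elim: s x => [|k s IHs] x /=; first by rewrite expr0 scale1r.
move=> /andP[ks us]; rewrite rev_cons -cats1 act_cat /= IHs // act_genC //.
by rewrite (negPf ks) addbF scalerA -exprD uphalf_half addnC.
Qed.

Lemma act_revK s x : act (rev s) (act s x) = (-1) ^+ count eps s *: x.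
Proof.
elim: s x => [|k s IHs] x /=; first by rewrite scale1r.
rewrite rev_cons -cats1 act_cat /= (ca_square JP) act_scale IHs scalerA.
by rewrite -exprD.
Qed.

End CliffordAction.

(** * Signed codes and the orbit of a fixed vector *)

Section Codes.
Variable K : finType.

(** A binary code on the generators, in systematic form.  The letters of
    code_free are the information letters; each other letter x is the pivot of
    one word x :: code_tail x of weight 4, the remaining letters of which are
    information letters.  The conditions code_sign and code_even make the
    associated operators commuting involutions.  By code_detect, a nonempty
    set D of information letters that meets all words evenly has a cardinal
    congruent to 1 or 2 modulo 4, that is, e_D is skew-adjoint. *)
Record signed_code (eps : pred K) := SignedCode {
  code_free : {set K};
  code_tail : K -> seq K;
  code_tail_free : forall x k,
    x \notin code_free -> k \in code_tail x -> k \in code_free;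
  code_uniq : forall x, x \notin code_free -> uniq (code_tail x);
  code_size : forall x, x \notin code_free -> size (code_tail x) = 3%N;
  code_sign : forall x, x \notin code_free ->
    ~~ odd (count eps (x :: code_tail x));
  code_even : forall x y, x \notin code_free -> y \notin code_free -> x != y ->
    ~~ odd (count (mem (code_tail y)) (code_tail x));
  code_detect : forall D : {set K}, D \subset code_free -> D != set0 ->
    (forall x, x \notin code_free -> ~~ odd (count (mem D) (code_tail x))) ->
    odd (uphalf #|D|) }.

End Codes.

Section CodeAction.
Variables (R : comNzRingType) (K : finType) (eps : pred K).
Variable C : signed_code eps.
Variables (W : lmodType R) (J : K -> W -> W).
Hypothesis JP : clifford_action eps J.
Local Notation act := (word_act J).
Local Notation Y := (code_free C).
Local Notation word x := (x :: code_tail C x).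

Lemma word_uniq x : x \notin Y -> uniq (word x).
Proof.
move=> xY; rewrite /= code_uniq // andbT.
by apply/negP => /(code_tail_free xY); apply/negP.
Qed.

(** As pivots are not information letters, the generator x anticommutes with
    its own word operator and commutes with those of the other pivots. *)
Lemma word_pivot x y : x \notin Y -> y \notin Y -> (x \in word y) = (x == y).
Proof.
move=> xY yY; rewrite inE; case: eqP => //= _.
by apply/negP => /(code_tail_free yY); apply/negP.
Qed.

Lemma word_genC x k u : x \notin Y ->
  act (word x) (J k u) = (-1) ^+ (k \in word x) *: J k (act (word x) u).
Proof.
by move=> xY; rewrite (act_genC JP) ?word_uniq //= code_size.
Qed.

Lemma word_actC x s u : x \notin Y ->
  act (word x) (act s u) =
    (-1) ^+ count (mem (word x)) s *: act s (act (word x) u).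
Proof.
move=> xY; elim: s => [|k s IHs]; first by rewrite /= scale1r.
rewrite [act (k :: s) u]/= word_genC // IHs (ca_scale JP) scalerA.
by rewrite -exprD.
Qed.

Lemma word_rev x u : x \notin Y -> act (rev (word x)) u = act (word x) u.
Proof.
move=> xY; rewrite (act_rev JP) ?word_uniq //= code_size //=.
by rewrite -signr_odd /= scale1r.
Qed.

Lemma word_involution x u : x \notin Y -> act (word x) (act (word x) u) = u.
Proof.
move=> xY; rewrite -[LHS]word_rev // (act_revK JP) -signr_odd.
by rewrite (negPf (code_sign xY)) scale1r.
Qed.

Lemma word_commute x y u : x \notin Y -> y \notin Y ->
  act (word x) (act (word y) u) = act (word y) (act (word x) u).
Proof.
move=> xY yY; have [->//|xy] := eqVneq x y.
rewrite [LHS]word_actC // -signr_odd.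
rewrite (_ : odd _ = false) ?scale1r //.
rewrite /= word_pivot // eq_sym (negPf xy) add0n.
rewrite (@eq_in_count _ _ (mem (code_tail C x))); last first.
  move=> k /(code_tail_free yY) kY /=; rewrite inE.
  by case: eqP => // kx; rewrite -kx kY in xY.
by apply/negbTE/code_even; rewrite // eq_sym.
Qed.

Definition code_fixed (u : W) :=
  forall x, x \notin Y -> act (word x) u = u.

(** A generator k sends e_I u to e_L u up to sign.  If k is an information
    letter, sort the word and cancel.  If k is a pivot, its word fixes u, so
    that J k u is up to sign the action of the tail, which consists of
    information letters. *)
Lemma code_orbit u k (I : {set K}) : code_fixed u -> I \subset Y ->
  exists2 L : {set K}, L \subset Y &
    eqpm (J k (act (enum I) u)) (act (enum L) u).
Proof.
move=> uP IY.
have reduce s : {subset s <= Y} -> exists2 L : {set K}, L \subset Y &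
    eqpm (act s u) (act (enum L) u).
  move=> sY; exists (odd_letters s); last exact: act_normal_form JP _ _.
  apply/subsetP => l; rewrite inE => ls; apply: sY.
  by rewrite -has_pred1 has_count; case: count ls.
have IsubY : {subset enum I <= Y} by move=> l; rewrite mem_enum; apply/subsetP.
have [kY|kY] := boolP (k \in Y).
  by apply: (reduce (k :: _)) => l; rewrite inE => /predU1P[->|/IsubY].
have Jku : eqpm (J k u) (act (code_tail C k) u).
  rewrite -{1}(uP k kY) /=; exact: gen_square_eqpm JP _ _.
have [|L LY HL] := reduce (enum I ++ code_tail C k).
  by move=> l; rewrite mem_cat => /orP[/IsubY//|]; apply: code_tail_free.
exists L => //; apply: eqpm_trans HL; rewrite act_cat.
apply: eqpm_trans (act_eqpm JP _ Jku).
exact/eqpm_sym/(act_gen_eqpm JP).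
Qed.

End CodeAction.

(** * Scalar products for which the generators are skew-adjoint *)

Lemma count_memC (T : eqType) (s t : seq T) : uniq s -> uniq t ->
  count (mem s) t = count (mem t) s.
Proof.
move=> us ut; rewrite -!size_filter; apply/perm_size/uniq_perm.
- exact: filter_uniq.
- exact: filter_uniq.
- by move=> x; rewrite !mem_filter /= andbC.
Qed.

Section SkewAction.
Variables (R : rcfType) (K : finType) (eps : pred K).
Variables (V : lmodType R) (S : {symmetric V}) (J : K -> V -> V).
Hypothesis JP : clifford_action eps J.
Hypothesis J_skew : forall k x y, S (J k x) y = - S x (J k y).
Local Notation act := (word_act J).

Lemma symC x y : S x y = S y x.
Proof. by rewrite hermC expr0 mul1r. Qed.

Lemma form_act s x y :
  S (act s x) y = (-1) ^+ size s * S x (act (rev s) y).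
Proof.
elim: s x y => [|k s IHs] x y /=; first by rewrite mul1r.
by rewrite J_skew IHs rev_cons -cats1 act_cat exprS mulN1r mulNr.
Qed.

Lemma form_gen2 k x y : S (J k x) (J k y) = (-1) ^+ (~~ eps k) * S x y.
Proof.
rewrite J_skew (ca_square JP) linearZr_LR /= signrN mulNr.
by case: (eps k); rewrite ?expr1 ?expr0.
Qed.

Lemma form_act2 s x y :
  S (act s x) (act s y) = (-1) ^+ count (predC eps) s * S x y.
Proof.
elim: s => [|k s IHs] /=; first by rewrite mul1r.
by rewrite form_gen2 IHs mulrA exprD.
Qed.

(** The adjoint of e_I is e_I up to the sign (-1)^(n (n + 1) / 2) for n = #|I|,
    and n (n + 1) / 2 has the parity of uphalf n. *)
Lemma skew_word_isotropic s x : uniq s -> odd (uphalf (size s)) ->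
  S (act s x) x = 0.
Proof.
move=> us odds; apply/eqP.
have : S (act s x) x = - S (act s x) x.
  rewrite {1}form_act (act_rev JP) // linearZr_LR /= mulrA -exprD -signr_odd.
  move: odds; rewrite uphalf_half oddD oddb oddD => ->.
  by rewrite expr1 mulN1r symC.
by move/eqP; rewrite -addr_eq0 -mulr2n mulrn_eq0.
Qed.

Variable C : signed_code eps.
Local Notation Y := (code_free C).
Local Notation word x := (x :: code_tail C x).
Local Notation fixed := (code_fixed C J).

Lemma word_selfadjoint p x y : p \notin Y ->
  S (act (word p) x) y = S x (act (word p) y).
Proof.
by move=> pY; rewrite form_act (word_rev JP) //= code_size // -signr_odd mul1r.
Qed.

Lemma act_add s x y : act s (x + y) = act s x + act s y.
Proof. by elim: s => //= k s ->; rewrite (ca_add JP). Qed.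

Lemma act_opp s x : act s (- x) = - act s x.
Proof. by rewrite -scaleN1r (act_scale JP) scaleN1r. Qed.

(** Induction on the pivots.  For P the involution of the next word, v + P v
    and v - P v are orthogonal with norms adding up to 4 S v v, so one of them
    is nonnull.  If it is v - P v, applying the pivot turns it into a fixed
    vector of P and keeps it fixed by the previous involutions. *)
Lemma exists_fixed_nonnull : (exists v, S v v != 0) ->
  exists2 v, S v v != 0 & fixed v.
Proof.
move=> [v0 v0P].
suff ind us : uniq us -> (forall x, x \in us -> x \notin Y) ->
    exists2 v, S v v != 0 & {in us, forall x, act (word x) v = v}.
  have [|x|v vP fv] := ind (enum (~: Y)); rewrite ?enum_uniq //.
    by rewrite mem_enum inE.
  by exists v => // x xY; apply: fv; rewrite mem_enum inE.
elim: us => [|p us IHus]; first by exists v0.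
rewrite cons_uniq => /andP[pus uus] usY.
have pY : p \notin Y by apply: (usY p); apply: mem_head.
have usY' x : x \in us -> x \notin Y.
  by move=> xus; apply: usY; rewrite inE xus orbT.
have [v vP fv] := IHus uus usY'.
pose P := act (word p).
have fixP x : x \in us -> act (word x) (P v) = P v.
  by move=> xus; rewrite /P (word_commute JP _ (usY' x xus) pY) (fv x).
have PP : P (P v) = v by apply: (word_involution JP).
have SPP : S (P v) (P v) = S v v by rewrite {1}/P word_selfadjoint // -/P PP.
have [plus0|plusN0] := eqVneq (S (v + P v) (v + P v)) 0; last first.
  exists (v + P v) => // x; rewrite inE => /predU1P[->|xus].
    by rewrite act_add -/P PP addrC.
  by rewrite act_add fixP // (fv x).
exists (J p (v - P v)) => [|x].
  rewrite form_gen2 mulf_neq0 ?signr_eq0 //; apply/eqP => minus0.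
  move: vP; have /eqP := congr2 +%R plus0 minus0.
  rewrite addr0 linearDl linearBl /= !linearDr !linearNr /= SPP (symC (P v) v).
  set a := S v v; set b := S v (P v).
  have -> : a + b + (b + a) + (a - b - (b - a)) = a *+ 4 by ring.
  by rewrite mulrn_eq0 /= => ->.
rewrite inE => /predU1P[->|xus].
  rewrite (word_genC JP) // mem_head act_add act_opp -/P PP expr1 scaleN1r.
  by rewrite -scaleN1r -(ca_scale JP) scaleN1r opprB.
have xY := usY' x xus.
rewrite (word_genC JP) // word_pivot // act_add act_opp fixP // (fv x) //.
rewrite (_ : p == x = false) ?scale1r //.
by apply/eqP => px; rewrite px xus in pus.
Qed.

(** S (e_I v) (e_L v) reduces to S v (e_D v) with D the symmetric difference.
    If D meets some word oddly, then e_D v and v are eigenvectors of the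
    self-adjoint involution of that word for the eigenvalues -1 and 1;
    otherwise e_D is skew-adjoint by code_detect. *)
Lemma orbit_orthogonal v (I L : {set K}) : fixed v -> I \subset Y ->
  L \subset Y -> I != L -> S (act (enum I) v) (act (enum L) v) = 0.
Proof.
move=> fv IY LY IL.
rewrite symC form_act -act_cat; set s := rev _ ++ _.
have [b ->] := act_normal_form JP s v.
set D := odd_letters s.
have DP k : (k \in D) = (k \in I) (+) (k \in L).
  rewrite inE /s count_cat count_rev !count_uniq_mem ?enum_uniq // !mem_enum.
  by rewrite oddD !oddb addbC.
rewrite linearZr_LR /=; suff -> : S v (act (enum D) v) = 0 by rewrite !mulr0.
have DY : D \subset Y.
  apply/subsetP => k; rewrite DP.
  by case kI: (k \in I); case kL: (k \in L) => // _;
    [apply: (subsetP IY) | apply: (subsetP LY)].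
have D0 : D != set0.
  apply: contraNneq IL => D0; apply/eqP/setP => k.
  by have := DP k; rewrite D0 inE; case: (k \in I); case: (k \in L).
have [|] :=
  boolP [forall x, (x \notin Y) ==> ~~ odd (count (mem D) (code_tail C x))].
  move=> /forallP evenD.
  rewrite symC skew_word_isotropic ?enum_uniq // -cardE.
  by apply: (code_detect DY D0) => x xY; apply: (implyP (evenD x)).
rewrite negb_forall => /existsP[x]; rewrite negb_imply => /andP[xY oddx].
have oddD : odd (count (mem (word x)) (enum D)).
  rewrite count_memC ?word_uniq ?enum_uniq //=.
  rewrite (eq_count (a2 := mem D)) => [|k]; last by rewrite /= mem_enum.
  rewrite mem_enum (negPf (contra (subsetP DY x) xY)).
  by move: oddx; rewrite negbK.
set w := act (enum D) v.
have Pw : act (word x) w = - w.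
  by rewrite (word_actC JP) // fv // -signr_odd oddD expr1 scaleN1r.
have := word_selfadjoint v w xY; rewrite fv // Pw linearNr /= => /eqP.
by rewrite -addr_eq0 -mulr2n mulrn_eq0 /= => /eqP.
Qed.

End SkewAction.

(** * Existence of signed codes *)

Lemma card_count (T : finType) (s : seq T) (P : pred T) :
  uniq s -> (forall x, x \in s) -> #|P| = count P s.
Proof.
move=> us sT; rewrite cardE -size_filter; apply/perm_size/uniq_perm.
- exact: enum_uniq.
- exact: filter_uniq.
- by move=> x; rewrite mem_enum mem_filter sT andbT.
Qed.

Section CodeExistence.

Definition has_signed_code p q :=
  exists (K : finType) (eps : pred K) (_ : signed_code eps),
    #|eps| = p /\ #|predC eps| = q.

Local Notation quad := (bool * bool)%type.
Definition quads : seq quad :=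
  [:: (false, false); (false, true); (true, false); (true, true)].

(** The extended Hamming code in systematic form: the letters (false, i) are the
    four pivots, the letters (true, j) the four information letters, and the
    word of the pivot i contains every (true, j) with j <> i. *)
Definition hamming_tail (i : quad) : seq (bool * quad) :=
  [seq (true, j) | j <- quads & j != i].

Section Block.
Variables (sigma : pred (bool * quad)) (K : finType) (eps : pred K).
Variable C : signed_code eps.
Hypothesis sigma_even : forall i,
  ~~ odd (count sigma ((false, i) :: hamming_tail i)).
Local Notation K' := ((bool * quad) + K)%type.

Definition block_sign : pred K' :=
  fun x => match x with inl y => sigma y | inr y => eps y end.
Definition block_free : {set K'} :=
  [set x : K' | match x with inl y => y.1 | inr y => y \in code_free C end].
Definition block_tail (x : K') : seq K' :=
  match x with
  | inl y => map inl (hamming_tail y.2)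
  | inr y => map inr (code_tail C y)
  end.

Lemma block_free_l y : (inl y \in block_free) = y.1.
Proof. by rewrite inE. Qed.

Lemma block_free_r y : (inr y \in block_free) = (y \in code_free C).
Proof. by rewrite inE. Qed.

(** In a block, a set of information letters that meets the four words evenly is
    empty: comparing the parities shows that it contains all four letters or
    none, and in the former case it meets each word in three letters.  Hence D
    in code_detect lies in the original code. *)
Lemma block_code : signed_code block_sign.
Proof.
have inlI : injective (@inl (bool * quad) K) by move=> x y [].
have inrI : injective (@inr (bool * quad) K) by move=> x y [].
exists block_free block_tail.
- move=> [y|y] k; rewrite ?block_free_l ?block_free_r => yY /mapP[z].
    by case/mapP=> j _ -> ->; rewrite block_free_l.
  by move=> /(code_tail_free yY) zY ->; rewrite block_free_r.
- move=> [[t i]|y]; rewrite ?block_free_l ?block_free_r => yY;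
    rewrite map_inj_uniq ?code_uniq //.
  by case: i {yY} => [[] []].
- move=> [[t i]|y]; rewrite ?block_free_l ?block_free_r => yY; rewrite size_map.
    by case: i {yY} => [[] []].
  exact: code_size.
- move=> [[t i]|y]; rewrite ?block_free_l ?block_free_r => yY.
    by move: yY (sigma_even i) => /= /negPf ->; rewrite count_map.
  by have := code_sign yY; rewrite /= count_map.
- move=> [[t i]|x] [[u j]|y]; rewrite ?block_free_l ?block_free_r => xY yY xy.
  + move: xY yY xy => /= /negPf -> /negPf ->.
    by case: i j => [[] []] [[] []].
  + rewrite /= count_map (eq_count (a2 := pred0)) ?count_pred0 // => k /=.
    by apply/mapP => -[].
  + rewrite /= count_map (eq_count (a2 := pred0)) ?count_pred0 // => k /=.
    by apply/mapP => -[].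
  + rewrite /= count_map (eq_count (a2 := mem (code_tail C y))).
      by apply: code_even.
    by move=> k /=; rewrite mem_map.
- move=> D DY D0 evenD.
  have DP x : x \in D -> x \in block_free by apply: (subsetP DY).
  have Dl y : (inl y \in D) = false.
    case: y => -[] j; last by apply/negP => /DP; rewrite block_free_l.
    have hP i : ~~ odd
        (count (fun k => inl (true, k) \in D) [seq j <- quads | j != i]).
      have := evenD (inl (false, i)); rewrite block_free_l /= !count_map.
      by apply.
    move: (hP (false, false)) (hP (false, true)).
    move: (hP (true, false)) (hP (true, true)); rewrite /=.
    by case: j => [[] []]; do 4!case: (_ \in D).
  pose D' := [set y : K | inr y \in D].
  have DE : D = inr @: D'.
    apply/setP => -[y|y]; first by rewrite Dl; apply/esym/imsetP => -[].
    by rewrite mem_imset // inE.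
  rewrite DE card_imset //; apply: (@code_detect _ _ C).
  + by apply/subsetP => y; rewrite inE => /DP; rewrite block_free_r.
  + by apply: contraNneq D0 => D'0; rewrite DE D'0 imset0.
  + move=> x xY; have := evenD (inr x); rewrite block_free_r => /(_ xY).
    rewrite /= count_map (eq_count (a2 := mem D')) // => y /=.
    by rewrite inE.
Qed.

End Block.

Lemma card_sum_pred (A B : finType) (P : pred (A + B)) :
  #|P| = (#|[pred x | P (inl x)]| + #|[pred x | P (inr x)]|)%N.
Proof.
by rewrite -!sum1_card big_sumType.
Qed.

Lemma add_block (sigma : pred (bool * quad)) p q :
  (forall i, ~~ odd (count sigma ((false, i) :: hamming_tail i))) ->
  has_signed_code p q ->
  has_signed_code (#|sigma| + p) (#|predC sigma| + q).
Proof.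
move=> sigma_even [K [eps [C [<- <-]]]].
exists _, (block_sign sigma eps), (block_code C sigma_even).
by rewrite !card_sum_pred.
Qed.

(** The empty code is enough for at most two generators: a nonempty D then has
    cardinal 1 or 2. *)
Lemma trivial_code (K : finType) (eps : pred K) : (#|K| <= 2)%N ->
  signed_code eps.
Proof.
move=> K2; exists [set: K] (fun=> [::]).
- by move=> x k; rewrite inE.
- by move=> x; rewrite inE.
- by move=> x; rewrite inE.
- by move=> x; rewrite inE.
- by move=> x y; rewrite inE.
move=> D _; rewrite -card_gt0 => D0 _.
have := leq_trans (max_card D) K2.
by case: #|D| D0 => [|[|[|]]].
Qed.

Definition quad_tail := behead quads.

(** For signature (2, 2), the product of all four generators is the only word;
    a nonempty D that meets it evenly has cardinal 2. *)
Lemma quad_code : signed_code (fun x : quad => x.1).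
Proof.
exists [set x | x != (false, false)] (fun=> quad_tail).
- by move=> x k _; rewrite !inE; case: k => [[] []].
- by [].
- by [].
- by move=> x; rewrite inE negbK => /eqP ->.
- by move=> x y; rewrite !inE !negbK => /eqP -> /eqP ->.
- move=> D DY D0 evenD.
  have DE : #|D| = count (mem D) quad_tail.
    have : (false, false) \notin D.
      by apply/negP => /(subsetP DY); rewrite inE.
    rewrite (@card_count _ quads (mem D)) //= => [/negPf -> //|].
    by move=> [[] []].
  have := evenD (false, false); rewrite inE => /(_ isT).
  by rewrite -DE; rewrite -card_gt0 DE in D0 *; move: D0; rewrite /=;
    do 3!case: (_ \in D).
Qed.

Lemma has_signed_code_base r : (r < 3)%N -> has_signed_code r r.
Proof.
case: r => [|[|[|]]] // _.
- have void2 : (#|{: void}| <= 2)%N by rewrite card_void.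
  exists void, pred0; exists (trivial_code _ void2).
  by split; rewrite ?card0 // eq_card0 // => -[].
- exists bool, id; exists (trivial_code _ (eq_leq card_bool)).
  by split; rewrite (@card_count _ [:: true; false]) // => -[].
- exists quad, (fun x => x.1); exists quad_code.
  by split; rewrite (@card_count _ quads) // => -[[] []].
Qed.

(** A block may be added with all signs positive, with all signs negative, or
    with four signs of each kind, the negative letters then being those of one
    Hamming word: Hamming words meet each other evenly. *)
Lemma has_signed_code_mod4 r a b c : (r < 3)%N ->
  has_signed_code (r + 8 * a + 4 * c) (r + 8 * b + 4 * c).
Proof.
move=> /has_signed_code_base hr.
pose block := [seq (t, i) | t <- [:: true; false], i <- quads].
have card_block (P : pred (bool * quad)) : #|P| = count P block.
  by apply: card_count => // -[[] [[] []]].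
have step sigma m n p q :
    (forall i, ~~ odd (count sigma ((false, i) :: hamming_tail i))) ->
    #|sigma| = m -> #|predC sigma| = n ->
    has_signed_code p q -> has_signed_code (m + p) (n + q).
  by move=> ? <- <-; apply: add_block.
have neutral p q : has_signed_code p q -> has_signed_code (4 + p) (4 + q).
  apply: (step (fun x => x.1 (+) (x.2 != (false, false)))); rewrite ?card_block //.
  by move=> [[] []].
have pos p q : has_signed_code p q -> has_signed_code (8 + p) q.
  by apply: (step predT _ 0%N); rewrite ?card_block // => -[[] []].
have neg p q : has_signed_code p q -> has_signed_code p (8 + q).
  by apply: (step pred0 0%N); rewrite ?card_block // => -[[] []].
elim: c => [|c IHc]; last first.
  by rewrite mulnS addnCA [X in has_signed_code _ X]addnCA; apply: neutral.
rewrite !addn0; elim: a => [|a IHa]; last first.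
  by rewrite mulnS addnCA; apply: pos.
elim: b => [|b IHb]; last first.
  by rewrite mulnS [X in has_signed_code _ X]addnCA; apply: neg.
by rewrite muln0 addn0.
Qed.

End CodeExistence.

(** * Submodules of admissible modules *)

Section Submodule.
Variables (R : realType) (r s : nat) (M : admissible_module R r s).
Local Notation V := (am_space M).
Local Notation S := (am_form M).
Variable U : {vspace V}.
Hypothesis U_neq0 : (0 < \dim U)%N.
Hypothesis U_stable : forall (Z : 'rV[R]_(r + s)) v,
  v \in U -> am_rep M (cl_gen Z) v \in U.
Hypothesis U_nondegenerate : forall u, u \in U ->
  (forall v, v \in U -> S u v = 0) -> u = 0.

Lemma rep_stable (a : Cl R r s) v : v \in U -> am_rep M a v \in U.
Proof.
elim/cl_ind: a v; elim=> [Z|a|x IHx y IHy|x IHx y IHy] v vU.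
- exact: U_stable.
- rewrite -[cl_pi _]/(cl_scal r s a) cl_scalE linearZ /= am_rep1.
  by rewrite scale_lfunE id_lfunE memvZ.
- rewrite -cl_addE -[cl_add _ _]/(cl_pi x + cl_pi y) linearD add_lfunE.
  by rewrite memvD ?IHx ?IHy.
- by rewrite -cl_mulE (am_repM M (cl_pi x)) comp_lfunE IHx ?IHy.
Qed.

Definition sub_rep (a : Cl R r s) : 'End(subvs_of U) :=
  linfun (vsproj U \o am_rep M a \o vsval).

Lemma sub_repE a u : vsval (sub_rep a u) = am_rep M a (vsval u).
Proof. by rewrite lfunE /= vsprojK // rep_stable ?subvsP. Qed.

Lemma sub_rep_linear : linear sub_rep.
Proof.
move=> c a b; apply/lfunP => u; apply/val_inj => /=.
rewrite -[LHS]/(vsval _) sub_repE linearP /= add_lfunE scale_lfunE.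
by rewrite add_lfunE scale_lfunE linearP /= !sub_repE.
Qed.
HB.instance Definition _ := GRing.isLinear.Build R (Cl R r s) 'End(subvs_of U)
  *:%R sub_rep sub_rep_linear.

Definition sub_form (u v : subvs_of U) : R := S (vsval u) (vsval v).

(** The second scaling law has to be written in the syntactic form that symmetric
    forms carry, so that their structure is inferred for sub_form. *)
Lemma sub_form_bilinear : bilinear_for *%R (@idfun R \; *%R) sub_form.
Proof.
by split=> w a u v; rewrite /= /sub_form linearP /= ?linearPl ?linearPr.
Qed.
HB.instance Definition _ := bilinear_isBilinear.Build R
  (subvs_of U) (subvs_of U) R *%R (@idfun R \; *%R) sub_form sub_form_bilinear.

Lemma sub_form_sym : forall u v : subvs_of U,
  sub_form u v = (-1) ^+ false * idfun (sub_form v u).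
Proof. by move=> u v; rewrite /sub_form hermC. Qed.
HB.instance Definition _ := isHermitianSesquilinear.Build R (subvs_of U)
  false (@idfun R) sub_form sub_form_sym.

Lemma sub_rep1 : sub_rep 1 = \1%VF.
Proof.
by apply/lfunP => u; apply/val_inj; rewrite /= -[LHS]/(vsval _) sub_repE
  am_rep1 !id_lfunE.
Qed.

Lemma sub_repM a b : sub_rep (a * b) = (sub_rep a \o sub_rep b)%VF.
Proof.
apply/lfunP => u; apply/val_inj; rewrite /= -[LHS]/(vsval _) comp_lfunE.
by rewrite -[RHS]/(vsval _) !sub_repE am_repM comp_lfunE.
Qed.

Lemma dim_subvs : \dim {: subvs_of U} = \dim U.
Proof. by rewrite dimvf. Qed.

Lemma sub_nondegenerate : nondegenerate sub_form.
Proof.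
rewrite /nondegenerate /= -subv0; apply/subvP => u /mem_orthovP uP.
rewrite memv0; apply/eqP/val_inj; apply: U_nondegenerate.
  exact: subvsP.
move=> v vU; have := uP (vsproj U v) (memvf _).
by rewrite /= /sub_form vsprojK.
Qed.

Lemma sub_skew (Z : 'rV[R]_(r + s)) (v w : subvs_of U) :
  sub_form (sub_rep (cl_gen Z) v) w = - sub_form v (sub_rep (cl_gen Z) w).
Proof. by rewrite /sub_form !sub_repE am_skew. Qed.

Definition submodule : admissible_module R r s :=
  @AdmissibleModule R r s (subvs_of U) sub_rep sub_form sub_rep1 sub_repM
    (etrans (congr1 (leq 1) dim_subvs) U_neq0) sub_nondegenerate sub_skew.

(** The restriction of the module structure to U is itself an admissible module,
    of dimension at least that of M when M is minimal. *)
Lemma minimal_no_submodule : minimal_admissible M -> U = fullv.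
Proof.
move=> /(_ submodule) /=; rewrite dim_subvs => dimU.
by apply/eqP; rewrite eqEdim subvf.
Qed.

End Submodule.

(** * The orthonormal basis given by the orbit *)

Section OrthonormalBasis.
Variables (F : fieldType) (V : vectType F) (S : {symmetric V}) (T : finType).

Record orthobasis (b : T -> V) (g : T -> F) : Prop := OrthoBasis {
  ob_gram : forall s t, S (b s) (b t) = (s == t)%:R * g t;
  ob_sign : forall t, g t * g t = 1;
  ob_expand : forall x, x = \sum_t (g t * S x (b t)) *: b t }.

Lemma orthobasis_rescale (b : T -> V) (g : T -> F) (n : T -> nat) :
  orthobasis b g -> orthobasis (fun t => (-1) ^+ n t *: b t) g.
Proof.
have e2 t : (-1) ^+ n t * (-1) ^+ n t = 1 :> F by rewrite -expr2 sqrr_sign.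
move=> [bg gg bx]; split=> // [s t|x].
  rewrite linearZl_LR linearZr_LR /= bg.
  have [->|st] := eqVneq s t; last by rewrite !mul0r !mulr0.
  by rewrite /= mulrA e2 mul1r.
rewrite {1}[x]bx; apply: eq_bigr => t _; rewrite linearZr_LR /= scalerA.
by congr (_ *: _); rewrite /= mulrAC -mulrA [_ ^+ _ * (_ * _)]mulrA e2 mul1r.
Qed.

Variables (b : T -> V) (g : T -> F).

(** The orthogonal expansion is linear in x and holds on the family itself. *)
Lemma orthogonal_span : (forall s t, S (b s) (b t) = (s == t)%:R * g t) ->
  (forall t, g t * g t = 1) -> forall x, x \in <<codom b>>%VS ->
  x = \sum_t (g t * S x (b t)) *: b t.
Proof.
move=> bg gg; pose p x := \sum_t (g t * S x (b t)) *: b t - x.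
have p_lin : linear p.
  move=> a x y; rewrite /p scalerBr scaler_sumr addrACA -opprD -big_split.
  congr (_ - _); apply: eq_bigr => t _ /=.
  by rewrite linearPl scalerA -scalerDl; congr (_ *: _); ring.
pose P : {linear V -> V} := HB.pack p (GRing.isLinear.Build _ _ _ _ p p_lin).
have : (<<codom b>> <= lker (linfun P))%VS.
  apply/span_subvP => _ /codomP[s ->]; rewrite memv_ker lfunE /= /p.
  rewrite (bigD1 s) //= big1 => [|t ts].
    by rewrite bg eqxx mul1r gg scale1r addr0 subrr.
  by rewrite bg eq_sym (negPf ts) mul0r mulr0 scale0r.
move=> /subvP h x /h; rewrite memv_ker lfunE /= subr_eq0 => /eqP -> //.
Qed.

Lemma orthobasis_dim : orthobasis b g -> \dim {:V} = #|T|.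
Proof.
move=> [bg gg bx]; pose X := [tuple of codom b].
suff /size_basis : basis_of {:V} X by [].
rewrite basisEfree subvf /=; apply/andP; split.
  apply/freeP => k k0 i.
  have := congr1 (fun x => S x (b (enum_val i))) k0.
  rewrite linear0l linear_sumlz (bigD1 i) //= big1 => [|j ji].
    rewrite linearZl_LR /= (nth_map (enum_val i)) -?cardE ?ltn_ord //.
    rewrite -enum_val_nth bg eqxx mul1r addr0 => /eqP; rewrite mulf_eq0.
    case/orP=> /eqP // g0; have := gg (enum_val i).
    by rewrite g0 mul0r => /esym/eqP; rewrite oner_eq0.
  rewrite linearZl_LR /= (nth_map (enum_val i)) -?cardE ?ltn_ord //.
  rewrite -enum_val_nth bg (inj_eq enum_val_inj) (negPf ji).
  by rewrite mul0r mulr0.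
suff XV : (fullv <= <<X>>)%VS.
  by rewrite (leq_trans (dimvS XV)) // (leq_trans (dim_span _)).
apply/subvP => x _; rewrite [x]bx; apply: memv_suml => t _.
by rewrite memvZ // memv_span // codom_f.
Qed.

End OrthonormalBasis.

Section ModuleAction.
Variables (R : realType) (r s : nat) (M : admissible_module R r s).
Local Notation V := (am_space M).
Local Notation S := (am_form M).

Lemma pe_form_delta (i j : 'I_(r + s)) :
  pe_form (delta_mx 0 i) (delta_mx 0 j) = (i == j)%:R * pe_sign R i.
Proof.
rewrite pe_formE (bigD1 i) //= big1 => [|k ki].
  by rewrite !mxE !eqxx /= mul1r addr0 mulrC.
by rewrite !mxE eqxx (negPf ki) mul0r mulr0.
Qed.

Lemma rep_gen_square Z v :
  am_rep M (cl_gen Z) (am_rep M (cl_gen Z) v) = - pe_form Z Z *: v.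
Proof.
rewrite -comp_lfunE -am_repM cl_gen_square linearZ /= am_rep1.
by rewrite scale_lfunE id_lfunE.
Qed.

Lemma rep_gen_anticommute Z W v : pe_form Z W = 0 ->
  am_rep M (cl_gen Z) (am_rep M (cl_gen W) v) =
  - am_rep M (cl_gen W) (am_rep M (cl_gen Z) v).
Proof.
move=> ZW; have := rep_gen_square (Z + W) v.
rewrite !linearD /= !add_lfunE !linearD /= !rep_gen_square.
rewrite linearDl !linearDr /= ZW [pe_form W Z]pe_formC ZW addr0 add0r.
set a := pe_form Z Z; set c := pe_form W W => h.
apply/eqP; rewrite -addr_eq0; apply/eqP/(addrI (- a *: v))/(addIr (- c *: v)).
by rewrite addr0 -scalerDl -opprD -h !addrA.
Qed.

Variables (K : finType) (beta : K -> 'I_(r + s)) (eps : pred K).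
Hypothesis beta_inj : injective beta.
Hypothesis beta_eps : forall k, (beta k < r)%N = eps k.

Definition frame_gen (k : K) (v : V) : V :=
  am_rep M (cl_gen (delta_mx 0 (beta k))) v.

Lemma pe_sign_frame k : pe_sign R (beta k) = (-1) ^+ (~~ eps k).
Proof. by rewrite /pe_sign beta_eps; case: (eps k). Qed.

Lemma frame_action : clifford_action eps frame_gen.
Proof.
split=> [k a x y|k x|k l x kl]; rewrite /frame_gen.
- by rewrite linearP.
- rewrite rep_gen_square pe_form_delta eqxx mul1r pe_sign_frame.
  by rewrite signrN opprK.
- by rewrite rep_gen_anticommute // pe_form_delta (inj_eq beta_inj) (negPf kl) mul0r.
Qed.

Lemma frame_skew k v w : S (frame_gen k v) w = - S v (frame_gen k w).
Proof. exact: am_skew. Qed.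

(** Polarization: if u and w are null and S u w <> 0, then u + w is nonnull. *)
Lemma exists_nonnull : exists v, S v v != 0.
Proof.
pose u := vpick {:V}.
have u0 : u != 0 by rewrite vpick0 -dimv_eq0 -lt0n am_nonzero.
have [w uw] : exists w, S u w != 0.
  have : u \notin orthov S {:V}.
    by have /eqP-> := am_nondegenerate M; rewrite memv0.
  by case/mem_orthovPn=> w _; exists w.
have [uu|] := eqVneq (S u u) 0; last by exists u.
have [ww|] := eqVneq (S w w) 0; last by exists w.
exists (u + w); rewrite linearDl !linearDr /= uu ww addr0 add0r (symC _ w).
by rewrite -mulr2n mulrn_eq0.
Qed.

Lemma exists_fixed_vector (C : signed_code eps) :
  exists v (e : bool), S v v = (-1) ^+ e /\ code_fixed C frame_gen v.
Proof.
have [v vv fv] := exists_fixed_nonnull frame_action frame_skew C exists_nonnull.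
pose a := Num.sqrt `|S v v|.
have a0 : a != 0 by rewrite sqrtr_eq0 -ltNge normr_gt0.
have aa : a * a = `|S v v| by rewrite -expr2 sqr_sqrtr.
have [e Sv] : exists e : bool, S v v = (-1) ^+ e * (a * a).
  by exists (S v v < 0)%R; rewrite aa -realEsign ?num_real.
exists (a^-1 *: v), e; split; last first.
  by move=> x xY; rewrite (act_scale frame_action) fv.
rewrite linearZl_LR linearZr_LR /= Sv.
by rewrite 2!(mulrCA a^-1 (_ ^+ _)) mulKf // mulVf // mulr1.
Qed.

Variable C : signed_code eps.
Hypothesis M_minimal : minimal_admissible M.
Local Notation act := (word_act frame_gen).

Definition orbit_index : finType := {I : {set K} | I \subset code_free C}.

Definition orbit_vector (v : V) (t : orbit_index) : V := act (enum (val t)) v.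

(** The value of S on e_I v when S v v = (-1) ^+ e. *)
Definition orbit_norm (e : bool) (t : orbit_index) : R :=
  (-1) ^+ (count (predC eps) (enum (val t)) + e).

(** The span of the orbit is stable under every J_Z and nondegenerate, as it has
    an orthonormal basis; minimality of M makes it the whole module. *)
Lemma orbit_orthobasis v (e : bool) :
    bijective beta -> S v v = (-1) ^+ e -> code_fixed C frame_gen v ->
  orthobasis S (orbit_vector v) (orbit_norm e).
Proof.
move=> [beta' betaK betaK'] vv fv; set b := orbit_vector v; set g := orbit_norm e.
have bg t u : S (b t) (b u) = (t == u)%:R * g u.
  have [<-|tu] := eqVneq t u.
    by rewrite mul1r (form_act2 frame_action frame_skew) vv -exprD.
  rewrite mul0r (orbit_orthogonal frame_action frame_skew fv) ?(valP t) ?(valP u) //.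
have gg t : g t * g t = 1 by rewrite -expr2 sqrr_sign.
have bx := orthogonal_span bg gg.
split=> // x; apply: (bx x); set U := (<<_>>)%VS; suff -> : U = fullv by apply: memvf.
pose t0 : orbit_index := Sub set0 (sub0set _).
have bU t : b t \in U by rewrite memv_span // codom_f.
apply: (minimal_no_submodule (M := M)) => //.
- rewrite lt0n dimv_eq0; apply: contraTneq (bU t0) => ->; rewrite memv0.
  apply/eqP => b0; have := bg t0 t0; rewrite eqxx mul1r b0 linear0l => /esym/eqP.
  by rewrite signr_eq0.
- move=> Z w wU; rewrite [w]bx // linear_sum memv_suml // => t _.
  rewrite linearZ memvZ //= [Z]row_sum_delta !linear_sum sum_lfunE memv_suml // => k _.
  rewrite !linearZ scale_lfunE memvZ // -[k]betaK'.
  have [L LY [c Jb]] := code_orbit frame_action (beta' k) fv (valP t).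
  rewrite [X in X \in _](Jb : _ = _) memvZ //.
  exact: (bU (Sub L LY)).
- move=> w wU wP; rewrite [w]bx // big1 // => t _.
  by rewrite wP // mulr0 scale0r.
Qed.

End ModuleAction.

Arguments frame_gen [R r s] M [K] beta k v.
Arguments orbit_vector [R r s] M [K] beta [eps C] v t.
Arguments orbit_norm R [K eps C] e t.

(** * Signed permutation bases are integral *)

Section FrameBasis.
Variables (R : realType) (r s : nat) (M : admissible_module R r s).
Local Notation V := (am_space M).
Local Notation S := (am_form M).
Variables (K : finType) (beta : K -> 'I_(r + s)).
Hypothesis beta_bij : bijective beta.
Variables (T : finType) (b : T -> V) (g : T -> R).
Hypothesis bP : orthobasis S b g.
Local Notation J := (frame_gen M beta).

Definition permuted_up_to_sign :=
  forall k t, exists u, eqpm (J k (b t)) (b u).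

Hypothesis J_perm : permuted_up_to_sign.

Definition frame_vector (d : bool) (k : K) : 'rV[R]_(r + s) :=
  (-1) ^+ d *: delta_mx 0 (beta k).

Lemma h_bracket_coord x y k :
  h_bracket x y 0 (beta k) = pe_sign R (beta k) * S (J k x) y.
Proof. by rewrite mxE. Qed.

Lemma frame_gen_orthogonal k l x : k != l -> S (J k x) (J l x) = 0.
Proof.
move=> kl; apply/eqP.
have kl_x : S (J k x) (J l x) = S x (J l (J k x)).
  rewrite frame_skew /frame_gen rep_gen_anticommute ?linearNr ?opprK //.
  by rewrite pe_form_delta (bij_eq beta_bij) (negPf kl) mul0r.
have : S (J k x) (J l x) = - S (J k x) (J l x).
  by rewrite {2}kl_x -frame_skew; apply: symC.
by move/eqP; rewrite -addr_eq0 -mulr2n mulrn_eq0.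
Qed.

(** The k-th coordinate of the bracket is up to sign S (J k (b t)) (b u).  For
    l <> k the vector J l (b t) is orthogonal to J k (b t), hence to b u, so
    all other coordinates vanish. *)
Lemma frame_bracket d k t u : eqpm (J k (b t)) (b u) ->
  eqpm (h_bracket (b t) (b u)) (frame_vector d k).
Proof.
move=> Jb; have [a bu] := eqpm_sym Jb.
have [gamma gammaP] : exists gamma : bool,
    h_bracket (b t) (b u) 0 (beta k) = (-1) ^+ gamma.
  case: Jb => c Jb; rewrite h_bracket_coord Jb linearZl_LR /= (ob_gram bP) eqxx.
  have : (pe_sign R (beta k) * ((-1) ^+ c * (1 * g u))) ^+ 2 = 1.
    rewrite mul1r !exprMn sqrr_sign expr2 pe_signK expr2 (ob_sign bP).
    by rewrite !mul1r.
  move=> /eqP; rewrite sqrf_eq1 => /orP[/eqP|/eqP] ->; first by exists false.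
  by exists true.
exists (gamma (+) d); apply/rowP => j; case: beta_bij => beta' _ betaK'.
rewrite -[j]betaK'; set l := beta' j; rewrite !mxE eqxx /=.
rewrite signr_addb -mulrA mulrA -mulrA (mulrA ((-1) ^+ d)) -expr2 sqrr_sign mul1r.
have [->|lk] := eqVneq (beta l) (beta k).
  by rewrite mulr1 -gammaP mxE.
rewrite mulr0 bu linearZr_LR /= frame_gen_orthogonal ?mulr0 //.
by apply: contraNneq lk => ->.
Qed.

Lemma frame_bracket_target d k t u : eqpm (h_bracket (b t) (b u)) (frame_vector d k) ->
  eqpm (J k (b t)) (b u).
Proof.
move=> [c tu]; have [w [a Jw]] := J_perm k t.
have [<-|wu] := eqVneq w u; first by exists a.
have := h_bracket_coord (b t) (b u) k.
rewrite Jw linearZl_LR /= (ob_gram bP) (negPf wu) mul0r !mulr0 tu !mxE !eqxx.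
by rewrite mulr1 => /eqP; rewrite mulf_eq0 !signr_eq0.
Qed.

Lemma h_bracket_index t u : h_bracket (b t) (b u) = 0 \/
  exists k, eqpm (J k (b t)) (b u).
Proof.
have [/existsP[k kP]|] := boolP [exists k, S (J k (b t)) (b u) != 0].
  right; exists k; have [w [a Jw]] := J_perm k t.
  have [<-|wu] := eqVneq w u; first by exists a.
  by move: kP; rewrite Jw linearZl_LR /= (ob_gram bP) (negPf wu) mul0r mulr0 eqxx.
rewrite negb_exists => /forallP tu; left; apply/rowP => j.
case: beta_bij => beta' _ betaK'; rewrite -[j]betaK' h_bracket_coord mxE.
by move: (tu (beta' j)); rewrite negbK => /eqP ->; rewrite mulr0.
Qed.

Lemma eqpm_or (W : lmodType R) (x y : W) : eqpm x y <-> x = y \/ x = - y.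
Proof.
split=> [[[] ->]|[->|->]].
- by right; rewrite scaleN1r.
- by left; rewrite scale1r.
- exact: eqpm_refl.
- by exists true; rewrite scaleN1r.
Qed.

Definition basis_vector (i : 'I_#|T|) : V := b (enum_val i).
Definition basis_frame (d : bool) (i : 'I_#|K|) := frame_vector d (enum_val i).

Lemma frame_form d k l :
  pe_form (frame_vector d k) (frame_vector d l) = (k == l)%:R * pe_sign R (beta k).
Proof.
rewrite linearZl_LR linearZr_LR /= pe_form_delta (bij_eq beta_bij).
by rewrite mulrA -expr2 sqrr_sign mul1r.
Qed.

Lemma in_z_eqpm (Z W : 'rV[R]_(r + s)) :
  eqpm Z W -> in_z M Z = in_z M W \/ in_z M Z = - in_z M W.
Proof.
move=> /eqpm_or[->|->]; [by left | right].
by apply/pair_equal_spec; split; rewrite /= ?oppr0.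
Qed.

Lemma frame_integral_basis d : integral_basis basis_vector (basis_frame d).
Proof.
have cardK : #|K| = (r + s)%N by rewrite (bij_eq_card beta_bij) card_ord.
split.
- rewrite basisEdim; apply/andP; split.
    set U := (<<_>>)%VS.
    have vU x : in_v x \in U.
      rewrite [x](ob_expand bP); elim/big_ind: _ => [|y z yU zU|t _].
      - exact: mem0v.
      - rewrite [in_v _](_ : _ = in_v y + in_v z) ?memvD //.
        by apply/pair_equal_spec; rewrite /= addr0.
      - rewrite [in_v _](_ : _ = (g t * S x (b t)) *: in_v (b t)).
          rewrite memvZ // memv_span // mem_cat; apply/orP; left.
          apply/mapP; exists (enum_rank t); rewrite ?mem_enum //.
          by rewrite /basis_vector enum_rankK.
        by apply/pair_equal_spec; rewrite /= scaler0.
    have zU Z : in_z M Z \in U.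
      rewrite [Z]row_sum_delta; elim/big_ind: _ => [|Y W YU WU|j _].
      - exact: mem0v.
      - rewrite [in_z _ _](_ : _ = in_z M Y + in_z M W) ?memvD //.
        by apply/pair_equal_spec; rewrite /= addr0.
      - case: beta_bij => beta' _ betaK'; set k := beta' j.
        rewrite [in_z _ _](_ : _ = (Z 0 j * (-1) ^+ d) *: in_z M (frame_vector d k)).
          rewrite memvZ // memv_span // mem_cat; apply/orP; right.
          apply/mapP; exists (enum_rank k); rewrite ?mem_enum //.
          by rewrite /basis_frame enum_rankK.
        apply/pair_equal_spec; rewrite /= scaler0; split=> //.
        by rewrite /frame_vector /k betaK' scalerA -mulrA -expr2 sqrr_sign mulr1.
    apply/subvP => -[x Z] _.
    rewrite [(x, Z)](_ : _ = in_v x + in_z M Z) ?memvD //.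
    by apply/pair_equal_spec; rewrite /= addr0 add0r.
  rewrite size_cat (size_map _ (enum 'I_#|T|)) (size_map _ (enum 'I_#|K|)).
  rewrite !size_enum_ord cardK -(orthobasis_dim bP) !dimvf.
  by rewrite -[dim (pseudo_H_type M)]/(dim V + 1 * (r + s))%N mul1n.
- set e := _ ++ _.
  have size_v : size [seq in_v (basis_vector i) | i <- enum 'I_#|T|] = #|T|.
    by rewrite size_map size_enum_ord.
  have e_l i : e`_(lshift #|K| i) = in_v (basis_vector i).
    by rewrite nth_cat size_v /= ltn_ord (nth_map i) ?size_enum_ord // nth_ord_enum.
  have e_r i : e`_(rshift #|T| i) = in_z M (basis_frame d i).
    rewrite nth_cat size_v /= ltnNge leq_addr /= addKn.
    by rewrite (nth_map i) ?size_enum_ord // nth_ord_enum.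
  have zz : pe_form (0 : 'rV[R]_(r + s)) 0 = 0 by rewrite linear0l.
  split.
  + move=> i j; case: (split_ordP i) => i' ->; case: (split_ordP j) => j' ->;
      rewrite ?e_l ?e_r /h_form /= ?(linear0l, linear0r, zz, addr0, add0r) //.
    * rewrite (inj_eq (@lshift_inj _ _)) (ob_gram bP) (inj_eq enum_val_inj).
      by move=> /negPf ->; rewrite mul0r.
    * rewrite (inj_eq (@rshift_inj _ _)) frame_form (inj_eq enum_val_inj).
      by move=> /negPf ->; rewrite mul0r.
  + move=> x; rewrite mem_cat => /orP[] /mapP[i _ ->]; rewrite /h_form /=.
      rewrite zz addr0 (ob_gram bP) eqxx mul1r.
      by have /eqP := ob_sign bP (enum_val i); rewrite -expr2 sqrf_eq1 =>
        /orP[] /eqP; [left | right].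
    rewrite linear0l add0r frame_form eqxx mul1r /pe_sign.
    by case: ifP; [left | right].
- move=> i j c; have [tu0|[k Jk]] := h_bracket_index (enum_val i) (enum_val j).
    by left; rewrite /c /= /h_lie_br /= tu0.
  right; exists (enum_rank k); rewrite /c /= /h_lie_br /=.
  apply: in_z_eqpm; rewrite /basis_frame enum_rankK; exact: frame_bracket.
- move=> k i; have [u Ju] := J_perm (enum_val k) (enum_val i).
  exists (enum_rank u); split.
    apply: in_z_eqpm; rewrite /basis_vector enum_rankK; exact: frame_bracket.
  move=> j jk; have : eqpm (J (enum_val k) (b (enum_val i))) (b (enum_val j)).
    apply: (frame_bracket_target (d := d)); apply/eqpm_or.
    by case: jk => -[]; [left | right].
  move=> /(eqpm_trans (eqpm_sym Ju)) [a uj].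
  apply: enum_val_inj; rewrite enum_rankK; apply/eqP/contraT => uj'.
  have := ob_gram bP (enum_val j) (enum_val j).
  rewrite eqxx mul1r => jj; have := ob_sign bP (enum_val j).
  have [a' uj2] := eqpm_sym (ex_intro _ a uj).
  rewrite -jj {1}uj2 linearZl_LR /= (ob_gram bP) (negPf uj') mul0r mulr0 mul0r.
  by move/esym/eqP; rewrite oner_eq0.
Qed.

End FrameBasis.

(** * Isomorphisms from matching structure constants *)

Section BasisTransport.
Variables (F : fieldType) (V V' : vectType F).
Variables (S : {symmetric V}) (S' : {symmetric V'}) (T : finType).

Definition transport (b : T -> V) (g : T -> F) (b' : T -> V') (x : V) : V' :=
  \sum_t (g t * S x (b t)) *: b' t.

Lemma transport_linear b g b' : linear (transport b g b').
Proof.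
move=> a x y; rewrite /transport scaler_sumr -big_split; apply: eq_bigr => t _ /=.
by rewrite linearPl scalerA -scalerDl; congr (_ *: _); rewrite mulrDr mulrCA.
Qed.
HB.instance Definition _ b g b' :=
  GRing.isLinear.Build F V V' *:%R (transport b g b') (transport_linear b g b').

Lemma transport_basis b g b' t : orthobasis S b g -> transport b g b' (b t) = b' t.
Proof.
move=> bP; rewrite /transport (bigD1 t) //= big1 => [|u ut].
  by rewrite (ob_gram bP) eqxx mul1r (ob_sign bP) scale1r addr0.
by rewrite (ob_gram bP) eq_sym (negPf ut) mul0r mulr0 scale0r.
Qed.

End BasisTransport.

Lemma transportK (F : fieldType) (V V' : vectType F)
    (S : {symmetric V}) (S' : {symmetric V'}) (T : finType)
    (b : T -> V) (g : T -> F) (b' : T -> V') (g' : T -> F) :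
  orthobasis S b g -> orthobasis S' b' g' ->
  cancel (transport S b g b') (transport S' b' g' b).
Proof.
move=> bP b'P x; rewrite [in X in transport _ _ _ _ X]/transport linear_sum.
rewrite [RHS](ob_expand bP).
by apply: eq_bigr => t _; rewrite linearZ /= (transport_basis _ _ b'P).
Qed.

Section FrameMap.
Variables (R : realType) (r s r' s' : nat) (K : finType) (d : bool).
Variables (beta : K -> 'I_(r + s)) (beta' : K -> 'I_(r' + s')).

Definition frame_map (Z : 'rV[R]_(r + s)) : 'rV[R]_(r' + s') :=
  \sum_k Z 0 (beta k) *: frame_vector R beta' d k.

Lemma frame_map_coord Z k : injective beta' ->
  frame_map Z 0 (beta' k) = (-1) ^+ d * Z 0 (beta k).
Proof.
move=> beta'_inj; rewrite summxE (bigD1 k) //= big1 => [|l lk].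
  by rewrite !mxE !eqxx addr0 mulr1 mulrC.
by rewrite !mxE (inj_eq beta'_inj) eq_sym (negPf lk) !mulr0.
Qed.

End FrameMap.

Lemma frame_mapK (R : realType) (r s r' s' : nat) (K : finType) (d : bool)
    (beta : K -> 'I_(r + s)) (beta' : K -> 'I_(r' + s')) :
  bijective beta -> bijective beta' ->
  cancel (frame_map (R := R) d beta beta') (frame_map d beta' beta).
Proof.
move=> beta_bij beta'_bij Z; apply/rowP => j.
have [gamma _ betaK] := beta_bij; rewrite -[j]betaK.
rewrite !frame_map_coord; [|exact: bij_inj..].
by rewrite mulrA -expr2 sqrr_sign mul1r.
Qed.

Section Isomorphism.
Variables (R : realType) (r s r' s' : nat).
Variables (M : admissible_module R r s) (M' : admissible_module R r' s').
Variables (K T : finType) (beta : K -> 'I_(r + s)) (beta' : K -> 'I_(r' + s')).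
Hypotheses (beta_bij : bijective beta) (beta'_bij : bijective beta').
Variables (b : T -> am_space M) (g : T -> R).
Variables (b' : T -> am_space M') (g' : T -> R) (d : bool).
Hypotheses (bP : orthobasis (am_form M) b g)
           (b'P : orthobasis (am_form M') b' g').
Hypotheses (J_perm : permuted_up_to_sign beta b)
           (J'_perm : permuted_up_to_sign beta' b').
Hypothesis same_constants : forall k t u,
  pe_sign R (beta' k) * am_form M' (frame_gen M' beta' k (b' t)) (b' u) =
  (-1) ^+ d * (pe_sign R (beta k) * am_form M (frame_gen M beta k (b t)) (b u)).

(** The sign (-1)^d by which the structure constants differ is carried by the
    map between the centers. *)
Definition lie_map (x : pseudo_H_type M) : pseudo_H_type M' :=
  (transport (am_form M) b g b' x.1, frame_map d beta beta' x.2).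

Lemma lie_map_linear : linear lie_map.
Proof.
move=> a x y; apply/pair_equal_spec; rewrite /= linearP; split=> //.
rewrite scaler_sumr -big_split; apply: eq_bigr => k _.
by rewrite !mxE scalerDl -scalerA.
Qed.
HB.instance Definition _ := GRing.isLinear.Build R
  (pseudo_H_type M) (pseudo_H_type M') *:%R lie_map lie_map_linear.

Lemma transport_constants k x y :
  pe_sign R (beta' k) * am_form M' (frame_gen M' beta' k
    (transport (am_form M) b g b' x)) (transport (am_form M) b g b' y) =
  (-1) ^+ d * (pe_sign R (beta k) * am_form M (frame_gen M beta k x) y).
Proof.
rewrite {1 2}/transport [x in RHS](ob_expand bP) [y in RHS](ob_expand bP).
rewrite /frame_gen !linear_sum !mulr_sumr /=; apply: eq_bigr => u _.
rewrite !linear_sumlz !mulr_sumr; apply: eq_bigr => t _.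
rewrite !linearZ /= !linearZl_LR /=.
set c := g u * _; set a := g t * _.
have scale (p q n w z : R) : p * z = n * (q * w) ->
    p * (c * (a * z)) = n * (q * (c * (a * w))).
  move=> pz; transitivity (c * (a * (p * z))); first by ring.
  by rewrite pz; ring.
exact/scale/same_constants.
Qed.

Lemma lie_map_bracket x y :
  lie_map (lie_br _ x y) = lie_br (pseudo_H_type M') (lie_map x) (lie_map y).
Proof.
apply/pair_equal_spec; rewrite /= linear0; split=> //.
apply/rowP => j; case: beta'_bij => gamma _ betaK; rewrite -[j]betaK.
rewrite (frame_map_coord _ _ _ _ (bij_inj beta'_bij)) !h_bracket_coord.
by rewrite -transport_constants.
Qed.

Lemma lie_map_bijective : bijective lie_map.
Proof.
exists (fun x => (transport (am_form M') b' g' b x.1, frame_map d beta' beta x.2)).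
  move=> [x Z]; rewrite /lie_map /= (transportK bP b'P); congr (_, _).
  exact: frame_mapK.
move=> [x Z]; rewrite /lie_map /= (transportK b'P bP); congr (_, _).
exact: frame_mapK.
Qed.

Lemma matched_integral_isomorphic : integral_isomorphic M M'.
Proof.
exists #|T|, #|K|, (basis_vector b), (basis_frame R beta false).
exists (basis_vector b'), (basis_frame R beta' d), lie_map.
split.
- exact: frame_integral_basis bP J_perm _.
- exact: frame_integral_basis b'P J'_perm _.
- by split; [exact: lie_map_bijective | exact: lie_map_bracket].
- move=> i; apply/pair_equal_spec; split; first exact: transport_basis.
  rewrite /= /frame_map big1 // => k _; by rewrite mxE scale0r.
- move=> i; apply/pair_equal_spec; split; first exact: linear0.
  apply/rowP => j; case: beta'_bij => gamma _ betaK; rewrite -[j]betaK /=.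
  rewrite (frame_map_coord _ _ _ _ (bij_inj beta'_bij)) !mxE !eqxx mul1r.
  by rewrite (bij_eq beta_bij) (bij_eq beta'_bij).
Qed.

End Isomorphism.

(** * Comparing the two signatures *)

Section OppositeCode.
Variables (K : finType) (eps : pred K) (C : signed_code eps).

Lemma code_sign_opposite x : x \notin code_free C ->
  ~~ odd (count (predC eps) (x :: code_tail C x)).
Proof.
move=> xY; move: (code_sign xY); set w := x :: _.
have szw : size w = 4 by rewrite /= code_size.
have := congr1 odd (count_predC eps w); rewrite szw oddD.
by move=> + /negPf even_w; rewrite even_w => /= ->.
Qed.

Definition opposite_code : signed_code (predC eps) :=
  @SignedCode K (predC eps) (code_free C) (code_tail C) (@code_tail_free _ _ C)
    (@code_uniq _ _ C) (@code_size _ _ C) code_sign_opposite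
    (@code_even _ _ C) (@code_detect _ _ C).

End OppositeCode.

Section Products.
Variables (R : comNzRingType) (K : finType) (eps : pred K).
Variables (W W' : lmodType R) (J : K -> W -> W) (J' : K -> W' -> W').

Definition prod_action (k : K) (x : W * W') : W * W' := (J k x.1, J' k x.2).

Lemma prod_clifford_action : clifford_action eps J -> clifford_action eps J' ->
  clifford_action eps prod_action.
Proof.
move=> JP J'P; split=> [k a x y|k x|k l x kl]; apply/pair_equal_spec => /=.
- by rewrite (ca_linear JP) (ca_linear J'P).
- by rewrite (ca_square JP) (ca_square J'P).
- by rewrite (ca_anti JP) // (ca_anti J'P).
Qed.

Lemma act_prod s x :
  word_act prod_action s x = (word_act J s x.1, word_act J' s x.2).
Proof. by case: x => x y; elim: s => //= k s ->. Qed.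

(** Tensoring J' with a rotation of order 4 of the plane changes the sign of all
    squares and keeps anticommutation, so this is an action of the opposite
    signature. *)
Definition twist_action (k : K) (x : W' * W') : W' * W' := (J' k x.2, - J' k x.1).

Lemma twist_clifford_action : clifford_action (predC eps) J' ->
  clifford_action eps twist_action.
Proof.
move=> J'P; have J'N k x : J' k (- x) = - J' k x.
  by rewrite -scaleN1r (ca_scale J'P) scaleN1r.
split=> [k a x y|k x|k l x kl]; apply/pair_equal_spec => /=.
- by rewrite !(ca_linear J'P) opprD scalerN.
- by rewrite J'N !(ca_square J'P) /= -!scaleNr -signrN negbK.
- by rewrite !J'N !(ca_anti J'P _ kl).
Qed.

(** The rotation contributes a sign at each application to a vector of the
    first summand, that is, at every other letter of the word, starting with
    the last one. *)
Lemma act_twist s x : clifford_action (predC eps) J' ->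
  word_act twist_action s (x, 0) = (-1) ^+ uphalf (size s) *:
    (if odd (size s) then (0, word_act J' s x) else (word_act J' s x, 0)).
Proof.
move=> J'P; have J'0 k : J' k 0 = 0.
  by have := ca_scale J'P k 0 0; rewrite !scale0r.
elim: s => [|k s IHs]; first by rewrite scale1r.
rewrite [LHS]/= {}IHs -[size (k :: s)]/(size s).+1 [word_act J' (k :: s) x]/=.
move: (word_act J' s x) (size s) => w n.
rewrite -[uphalf n.+1]/(n./2.+1) -[odd n.+1]/(~~ odd n).
rewrite uphalf_half exprD exprS /twist_action.
case: (odd n) => /=; apply/pair_equal_spec; split=> /=;
  rewrite ?(scaler0, J'0, oppr0) // (ca_scale J'P) ?expr1 //.
by rewrite mul1r mulN1r scaleNr.
Qed.

End Products.

Section SimultaneousOrbits.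
Variables (R : comNzRingType) (K : finType) (eps : pred K) (C : signed_code eps).
Variables (V V' : lmodType R) (J : K -> V -> V) (J' : K -> V' -> V').
Hypotheses (JP : clifford_action eps J) (J'P : clifford_action (predC eps) J').
Variables (v : V) (v' : V').
Hypotheses (fv : code_fixed C J v) (fv' : code_fixed C J' v').
Hypothesis v'_neq0 : v' != 0.
Local Notation T := (orbit_index C).

(** The nonzero component of e_I (v', 0) under the twisted action. *)
Definition twisted_vector (t : T) : V' :=
  (-1) ^+ uphalf #|val t| *: word_act J' (enum (val t)) v'.

Lemma twisted_vector_neq0 t : twisted_vector t != 0.
Proof.
apply: contra_neq v'_neq0 => t0.
have act0 s : word_act J' s 0 = 0.
  by have := act_scale J'P s 0 0; rewrite !scale0r.
have := congr1 (fun w => (-1) ^+ uphalf #|val t| *: w) t0.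
rewrite scaler0 scalerA -expr2 sqrr_sign scale1r => t0'.
have := act_revK J'P (enum (val t)) v'; rewrite t0' act0 => /esym.
move=> /(congr1 (fun w => (-1) ^+ count (predC eps) (enum (val t)) *: w)).
by rewrite scaler0 scalerA -expr2 sqrr_sign scale1r.
Qed.

(** Let the generators act on V x (V' x V') by J and the twist of J'.  The
    orbit of (v, (v', 0)) is permuted up to sign by code_orbit, and each
    component inherits the same permutation with the same sign.  The summand
    of V' x V' in which a twisted vector sits gives the parity of u. *)
Lemma simultaneous_orbits k (t : T) : exists (u : T) (a : bool),
  [/\ odd #|val u| = ~~ odd #|val t|,
      J k (word_act J (enum (val t)) v) = (-1) ^+ a *: word_act J (enum (val u)) v
    & J' k (twisted_vector t) = (-1) ^+ (a (+) odd #|val u|) *: twisted_vector u].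
Proof.
have DP := prod_clifford_action JP (twist_clifford_action J'P).
pose w : V * (V' * V') := (v, (v', 0)).
have fw : code_fixed C (prod_action J (twist_action J')) w.
  (* A word has four letters, for which the twisting sign is (-1) ^+ 2. *)
  move=> x xY; rewrite act_prod (act_twist _ _ J'P) /= !code_size //=.
  rewrite sqrrN expr1n scale1r.
  have -> : J x (word_act J (code_tail C x) v) = v by apply: fv.
  by have -> : J' x (word_act J' (code_tail C x) v') = v' by apply: fv'.
have [U UY [a]] := code_orbit DP k fw (valP t).
rewrite !act_prod [LHS]/= => /pair_equal_spec[/= Jv].
rewrite !(act_twist _ _ J'P) -!cardE => Jv'.
have scale_if c (p : bool) (x : V') :
    c *: (if p then (0, x) else (x, 0)) = if p then (0, c *: x) else (c *: x, 0).
  by case: p; apply/pair_equal_spec; rewrite /= scaler0.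
have J'0 : J' k 0 = 0 by have := ca_scale J'P k 0 0; rewrite !scale0r.
pose u : T := Sub U UY.
move: Jv'; rewrite !scale_if -/(twisted_vector t).
rewrite -[_ *: word_act J' (enum U) v']/(twisted_vector u) => Jv'.
have au0 : (-1) ^+ a *: twisted_vector u != 0.
  apply: contra_neq (twisted_vector_neq0 u) => au0.
  rewrite -[LHS]scale1r -(sqrr_sign R a) expr2 -scalerA au0.
  exact: scaler0.
exists u, a; rewrite -[val u]/U; move: Jv'; rewrite /twist_action.
case: (odd #|val t|); case: (odd #|U|) => /pair_equal_spec[/= Jt Jt'].
- by move: au0; rewrite -Jt' J'0 oppr0 eqxx.
- by split; rewrite // addbF.
- by split; rewrite // addbT signrN scaleNr -Jt' opprK.
- by move: au0; rewrite -Jt J'0 eqxx.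
Qed.

End SimultaneousOrbits.

Lemma sign_preserving_bijection (K : finType) (eps : pred K) p q :
  #|eps| = p -> #|predC eps| = q ->
  exists2 beta : K -> 'I_(p + q), bijective beta &
    forall k, (beta k < p)%N = eps k.
Proof.
move=> cp cq; pose s := enum eps ++ enum (predC eps).
have size_s : size s = (p + q)%N by rewrite size_cat -!cardE cp cq.
have sK k : k \in s.
  rewrite mem_cat !mem_enum.
  by rewrite -[k \in predC eps]/(~~ eps k) -[k \in eps]/(eps k) orbN.
have idx k : (index k s < p + q)%N by rewrite -size_s index_mem.
exists (fun k => Ordinal (idx k)).
  apply: inj_card_bij => [k l [kl]|].
    by rewrite -(nth_index k (sK k)) kl nth_index.
  by rewrite card_ord -cp -cq cardC.
move=> k; rewrite /= index_cat mem_enum -[k \in eps]/(eps k) -cp cardE.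
case: ifP => [ek|_]; first by rewrite index_mem mem_enum.
by rewrite ltnNge leq_addr.
Qed.

(** In the bases e_I v and twisted_vector, the generators of the two modules act
    by the same permutation with signs that differ by the parity of the
    target; this parity is compensated by the norms, where each generator is
    positive for exactly one of the two signatures.  What remains is the sign
    of - S v v * S' v' v'. *)
Lemma swapped_integral_isomorphic (R : realType) p q
    (M : admissible_module R p q) (M' : admissible_module R q p) :
  has_signed_code p q -> minimal_admissible M -> minimal_admissible M' ->
  integral_isomorphic M M'.
Proof.
move=> [K [eps [C [cp cq]]]] minM minM'.
have [beta beta_bij beta_eps] := sign_preserving_bijection cp cq.
have cp' : #|predC (predC eps)| = p.
  by rewrite -cp; apply: eq_card => k; rewrite !inE negbK.
have [beta' beta'_bij beta'_eps] := sign_preserving_bijection cq cp'.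
pose C' := opposite_code C.
have JP := frame_action M (bij_inj beta_bij) beta_eps.
have J'P := frame_action M' (bij_inj beta'_bij) beta'_eps.
have [v [e [vv fv]]] := exists_fixed_vector M (bij_inj beta_bij) beta_eps C.
have [v' [e' [v'v' fv']]] := exists_fixed_vector M' (bij_inj beta'_bij) beta'_eps C'.
have v'_neq0 : v' != 0.
  by apply: contra_eq_neq v'v' => ->; rewrite linear0l eq_sym signr_eq0.
have bP := orbit_orthobasis (bij_inj beta_bij) beta_eps minM beta_bij vv fv.
have := orbit_orthobasis (bij_inj beta'_bij) beta'_eps minM' beta'_bij v'v' fv'.
pose n (t : orbit_index C) := uphalf #|val t|.
pose b' t := (-1) ^+ n t *: orbit_vector M' beta' v' t.
move=> /(orthobasis_rescale n) b'P.
have sim := simultaneous_orbits JP J'P fv fv' v'_neq0.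
apply: (matched_integral_isomorphic (d := ~~ (e (+) e')) beta_bij beta'_bij bP b'P).
- by move=> k t; have [u [a [_ Jt _]]] := sim k t; exists u, a.
- by move=> k t; have [u [a [_ _ Jt]]] := sim k t; exists u, (a (+) odd #|val u|).
move=> k t u; have [w [a [_ Jt Jt']]] := sim k t.
have -> : am_form M' (frame_gen M' beta' k (b' t)) (b' u) =
    (-1) ^+ (a (+) odd #|val w|) * ((w == u)%:R * orbit_norm R (C := C') e' u).
  rewrite [X in am_form M' X _](Jt' : _ = _) linearZl_LR /=; congr (_ * _).
  exact: (ob_gram b'P w u).
have -> : am_form M (frame_gen M beta k (orbit_vector M beta v t))
      (orbit_vector M beta v u) = (-1) ^+ a * ((w == u)%:R * orbit_norm R e u).
  rewrite [X in am_form M X _](Jt : _ = _) linearZl_LR /=; congr (_ * _).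
  exact: (ob_gram bP w u).
have [<-|_] := eqVneq w u; last by rewrite !mul0r !mulr0.
rewrite !mul1r (pe_sign_frame R beta_eps) (pe_sign_frame R beta'_eps) /orbit_norm.
have card_w : odd (count (predC eps) (enum (val w)))
    (+) odd (count (predC (predC eps)) (enum (val w))) = odd #|val w|.
  by rewrite cardE -oddD count_predC.
rewrite -!exprD -[LHS]signr_odd -[RHS]signr_odd !oddD !oddb -card_w /=.
congr (_ ^+ nat_of_bool _).
move: (odd (count _ _)) (odd (count _ _)) => c c'; clear.
by case: (eps k); case: e; case: e'; case: a; case: c; case: c'.
Qed.

Local Close Scope ring_scope.

Theorem theorem5p10 (R : realType) (r t1 t2 t3 : nat)
  (r_mod4 : r = 0 %[mod 4] \/ r = 1 %[mod 4] \/ r = 2 %[mod 4])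
  (not_all_zero : ~ (r = 0 /\ t1 = 0 /\ t2 = 0 /\ t3 = 0))
  (M : admissible_module R (r + 8 * t1 + 4 * t2) (r + 8 * t3 + 4 * t2))
  (M' : admissible_module R (r + 8 * t3 + 4 * t2) (r + 8 * t1 + 4 * t2))
  (std_M : standard_module M) (std_M' : standard_module M') :
  integral_isomorphic M M'.
Proof.
apply: swapped_integral_isomorphic std_M.1 std_M'.1.
have r3 : (r %% 4 < 3)%N by case: r_mod4 => [->|[->|->]].
(* The multiple of 4 in r only adds neutral blocks to those counted by t2. *)
rewrite (_ : r + 8 * t1 + 4 * t2 = r %% 4 + 8 * t1 + 4 * (r %/ 4 + t2))%N; last first.
  by rewrite {1}(divn_eq r 4); ring.
rewrite (_ : r + 8 * t3 + 4 * t2 = r %% 4 + 8 * t3 + 4 * (r %/ 4 + t2))%N; last first.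
  by rewrite {1}(divn_eq r 4); ring.
exact: has_signed_code_mod4.
Qed.
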